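(* Let $(M,\nabla)$ be a smooth manifold with a torsion-free, Ricci-flat affine connection $\nabla$. Then $\nabla$ has a preserved real volume form; and if $\nabla$ preserves a complex structure $J$, it also has a preserved complex volume form.
   Context: Ricci-flat means $\mathsf{Ric}=0$, where $\mathsf{Ric}(X,Y)=\mathrm{tr}_{\mathbb R}(Z\mapsto R_{(X,Z)}Y)$ and $R$ is the curvature of $\nabla$. A real volume form is a nonvanishing section of $\wedge^nT^*$ ($n=\dim M$). If $n=2m$ and $\nabla J=0$, a complex volume form is a nonvanishing section of $\wedge^{(m,0)}T^*=\wedge^m_{\mathbb C}T^*$. ''Preserved'' means parallel for $\nabla$, and existence is understood locally (near each point), i.e. at the level of the holonomy algebra. *)

(* Defs.v *)
From mathcomp Require Import all_boot all_order all_algebra.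
From mathcomp Require Import all_classical all_reals.
From mathcomp Require Import topology normedtype derive.
From mathcomp Require Import complex.

Set Implicit Arguments.
Unset Strict Implicit.
Unset Printing Implicit Defensive.

Import Order.TTheory GRing.Theory Num.Theory.
Import numFieldNormedType.Exports.

Local Open Scope classical_set_scope.
Local Open Scope ring_scope.

(* C^oo on the (open) set U: every iterated directional derivative exists and
   is Frechet differentiable at every point of U. *)
Definition smooth_on (R : realType) (n : nat) (W : normedModType R)
    (U : set 'rV[R]_n) (f : 'rV[R]_n -> W) : Prop :=
  forall (vs : seq 'rV[R]_n) (x : 'rV[R]_n), U x ->
    differentiable
      (foldr (fun v (g : 'rV[R]_n -> W) => fun y => 'D_v g y) f vs) x.

Record manifold (R : realType) (n : nat) : Type := Manifold {
  points :> topologicalType ;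
  points_hausdorff : hausdorff_space points ;
  points_second_countable : @second_countable points ;
  chart : Type ;
  domain : chart -> set points ;
  coords : chart -> points -> 'rV[R]_n ;
  param : chart -> 'rV[R]_n -> points ;
  domain_open : forall i, open (domain i) ;
  domain_cover : forall p : points, exists i, domain i p ;
  coords_open : forall i, open (coords i @` domain i) ;
  coordsK : forall i p, domain i p -> param i (coords i p) = p ;
  coords_continuous : forall i p, domain i p -> {for p, continuous (coords i)} ;
  param_continuous : forall i x, (coords i @` domain i) x ->
    {for x, continuous (param i)} ;
  transition_smooth : forall i j,
    smooth_on (coords i @` (domain i `&` domain j)) (coords j \o param i)
}.

Section Manifold.
Variables (R : realType) (n : nat) (M : manifold R n).

Definition transition (i j : chart M) : 'rV[R]_n -> 'rV[R]_n :=
  coords j \o param i.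

Definition image_in (i : chart M) (V : set M) : set 'rV[R]_n :=
  coords i @` (domain i `&` V).

Definition overlap (i j : chart M) (V : set M) : set 'rV[R]_n :=
  image_in i (domain j `&` V).

(* G x a b c is the Christoffel symbol Gamma^c_{ab}(x). *)
Definition christoffel_map (G : 'rV[R]_n -> 'I_n -> 'M[R]_n)
    (x u v : 'rV[R]_n) : 'rV[R]_n :=
  \sum_(a < n) u 0 a *: (v *m G x a).

(* An affine connection, given by its Christoffel symbols in every chart. With
   t the transition map from chart i to chart j, the last field expresses that
   nabla_U V does not depend on the chart, for V constant in the chart i: its
   component in the chart j at t y is then 'D_v t y. *)
Record connection : Type := Connection {
  christoffel : chart M -> 'rV[R]_n -> 'I_n -> 'M[R]_n ;
  christoffel_smooth : forall i a,
    smooth_on (image_in i setT) (fun x => christoffel i x a) ;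
  christoffel_compatible : forall i j x u v, overlap i j setT x ->
    'D_u (fun y => 'D_v (transition i j) y) x
      + christoffel_map (christoffel j) (transition i j x)
          (u *m jacobian (transition i j) x) (v *m jacobian (transition i j) x)
    = christoffel_map (christoffel i) x u v *m jacobian (transition i j) x
}.

(* Vector fields over a chart are represented by their components. *)
Definition vfield := 'rV[R]_n -> 'rV[R]_n.

Definition lie_bracket (X Y : vfield) : vfield :=
  fun x => 'D_(X x) Y x - 'D_(Y x) X x.

Variable nabla : connection.

Definition covariant (i : chart M) (X Y : vfield) : vfield :=
  fun x => 'D_(X x) Y x + christoffel_map (christoffel nabla i) x (X x) (Y x).

Definition torsion (i : chart M) (X Y : vfield) : vfield :=
  fun x => covariant i X Y x - covariant i Y X x - lie_bracket X Y x.

Definition curvature (i : chart M) (X Y Z : vfield) : vfield :=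
  fun x => covariant i X (covariant i Y Z) x
         - covariant i Y (covariant i X Z) x
         - covariant i (lie_bracket X Y) Z x.

(* The trace of Z |-> R_(X,Z) Y on the tangent space at x; as the curvature is
   tensorial, a tangent vector z may be extended to a constant field. *)
Definition ricci (i : chart M) (X Y : vfield) (x : 'rV[R]_n) : R :=
  \tr (lin1_mx (fun z : 'rV[R]_n => curvature i X (cst z) Y x)).

Definition torsion_free : Prop :=
  forall i (X Y : vfield),
    smooth_on (image_in i setT) X -> smooth_on (image_in i setT) Y ->
    forall x, image_in i setT x -> torsion i X Y x = 0.

Definition ricci_flat : Prop :=
  forall i (X Y : vfield),
    smooth_on (image_in i setT) X -> smooth_on (image_in i setT) Y ->
    forall x, image_in i setT x -> ricci i X Y x = 0.

(* An endomorphism field acts on tangent (row) vectors by v |-> v *m J i x.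
   Integrability is not required: it follows from [parallel_endo] when nabla is
   torsion-free. *)
Definition complex_structure (J : chart M -> 'rV[R]_n -> 'M[R]_n) : Prop :=
  [/\ forall i, smooth_on (image_in i setT) (J i),
      forall i j x, overlap i j setT x ->
        J i x *m jacobian (transition i j) x
        = jacobian (transition i j) x *m J j (transition i j x)
    & forall i x, image_in i setT x -> J i x *m J i x = - 1%:M].

(* nabla_X (J Y) = J (nabla_X Y) *)
Definition parallel_endo (J : chart M -> 'rV[R]_n -> 'M[R]_n) : Prop :=
  forall i (X Y : vfield),
    smooth_on (image_in i setT) X -> smooth_on (image_in i setT) Y ->
    forall x, image_in i setT x ->
      covariant i X (fun y => Y y *m J i y) x = covariant i X Y x *m J i x.

(* The k arguments of a k-form are the rows of a k x n matrix. *)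
Definition set_row (k : nat) (A : 'M[R]_(k, n)) (a : 'I_k) (w : 'rV[R]_n) :
    'M[R]_(k, n) :=
  \matrix_(b < k) (if b == a then w else row b A).

Definition alternating_form (k : nat) (f : 'M[R]_(k, n) -> R) : Prop :=
  (forall A a (c : R) (u w : 'rV[R]_n),
     f (set_row A a (c *: u + w)) = c * f (set_row A a u) + f (set_row A a w))
  /\ (forall A (a b : 'I_k), a != b -> row a A = row b A -> f A = 0).

Definition real_form_on (V : set M) (k : nat)
    (omega : chart M -> 'rV[R]_n -> 'M[R]_(k, n) -> R) : Prop :=
  [/\ forall i x, image_in i V x -> alternating_form (omega i x),
      forall i A, smooth_on (image_in i V) (fun x => omega i x A : R^o)
    & forall i j x A, overlap i j V x ->
        omega i x A
        = omega j (transition i j x) (A *m jacobian (transition i j) x)].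

(* (nabla_u omega)(v_1, ..., v_k) = u (omega (v_1, ..., v_k))
   - \sum_a omega (v_1, ..., nabla_u v_a, ..., v_k), with the v_a constant in
   the chart, so that nabla_u v_a is given by the Christoffel symbols only. *)
Definition covariant_form (k : nat)
    (omega : chart M -> 'rV[R]_n -> 'M[R]_(k, n) -> R)
    (i : chart M) (u x : 'rV[R]_n) (A : 'M[R]_(k, n)) : R :=
  'D_u (fun y => omega i y A : R^o) x
  - \sum_(a < k) omega i x
      (set_row A a (christoffel_map (christoffel nabla i) x u (row a A))).

Definition parallel_form_on (V : set M) (k : nat)
    (omega : chart M -> 'rV[R]_n -> 'M[R]_(k, n) -> R) : Prop :=
  forall i x u A, image_in i V x -> covariant_form omega i u x A = 0.

Definition preserved_real_volume_form_on (V : set M)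
    (omega : chart M -> 'rV[R]_n -> 'M[R]_(n, n) -> R) : Prop :=
  [/\ real_form_on V omega,
      forall i x, image_in i V x -> exists A, omega i x A != 0
    & parallel_form_on V omega].

Definition re_form (k : nat)
    (Omega : chart M -> 'rV[R]_n -> 'M[R]_(k, n) -> R[i]%C) i x A : R :=
  complex.Re (Omega i x A).

Definition im_form (k : nat)
    (Omega : chart M -> 'rV[R]_n -> 'M[R]_(k, n) -> R[i]%C) i x A : R :=
  complex.Im (Omega i x A).

(* Sections of the bundle of (m,0)-forms: complex-valued m-forms that are
   complex multilinear with respect to J. *)
Definition type_m0_form_on (J : chart M -> 'rV[R]_n -> 'M[R]_n)
    (V : set M) (m : nat)
    (Omega : chart M -> 'rV[R]_n -> 'M[R]_(m, n) -> R[i]%C) : Prop :=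
  [/\ real_form_on V (re_form Omega),
      real_form_on V (im_form Omega)
    & forall i x A a, image_in i V x ->
        Omega i x (set_row A a (row a A *m J i x)) = 'i%C * Omega i x A].

Definition preserved_complex_volume_form_on
    (J : chart M -> 'rV[R]_n -> 'M[R]_n) (V : set M) (m : nat)
    (Omega : chart M -> 'rV[R]_n -> 'M[R]_(m, n) -> R[i]%C) : Prop :=
  [/\ type_m0_form_on J V Omega,
      forall i x, image_in i V x -> exists A, Omega i x A != 0,
      parallel_form_on V (re_form Omega)
    & parallel_form_on V (im_form Omega)].

End Manifold.

(* Main.v *)
(* Let J be the identity or the parallel complex structure. Since J commutes with the
   curvature R, the first Bianchi identity turns tr(J R(X,Y)) into a difference of two
   Ricci terms. Ricci-flatness therefore kills the real and the complex trace of R, i.e.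
   the curvature of the determinant line bundles of T and of (T, J). On a coordinate
   ball B choose a frame theta of the complex dual of (T, J) (theta = 1 in the real
   case), normalised by A0 theta = 1 for a constant A0. Then nabla theta = theta b with
   b_u = - A0 Gamma_u theta, the 1-form tr b is closed, and the Poincare lemma gives h
   on B with dh = - tr b, so that exp(h) det(A theta) is a parallel form. *)
Require Import Defs.
From mathcomp Require Import all_boot all_order all_algebra perm.
From mathcomp Require Import all_classical all_reals.
From mathcomp Require Import topology normedtype derive landau.
From mathcomp Require Import measure lebesgue_measure lebesgue_integral ftc.
From mathcomp.analysis Require Import sequences exp trigo.
From mathcomp Require Import complex ring zify.

Set Implicit Arguments.
Unset Strict Implicit.
Unset Printing Implicit Defensive.

Import Order.TTheory GRing.Theory Num.Theory.
Import numFieldNormedType.Exports.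

Local Open Scope classical_set_scope.
Local Open Scope ring_scope.

(** * Smooth functions *)

(** Tangent vectors are rows and endomorphisms act on the right. A complex frame is thus an n x m
    matrix [theta] whose columns are functionals with J theta = i theta, and the wedge of its
    columns, evaluated on the rows of A, is det(A theta). Keeping A0 constant makes the connection
    matrix b explicit, because A0 annihilates the ordinary derivative of [theta]. What obstructs the
    closedness of tr b is the trace of the curvature K on the i-eigenspace of J, equal to (tr K - i
    tr(JK)) / 2: this is why both traces must vanish. In the complex case tr b is complex valued, so
    the correcting factor needs a complex exponent. The form is built in one chart and pulled back
    to all others, where it is parallel by the transformation law of the Christoffel symbols.
    Complex-valued maps are differentiated through their real and imaginary parts. *)

Lemma differentiable_linear_approx (R : numFieldType) (V W : normedModType R)
    (f : V -> W) (df : {linear V -> W}) (x : V) :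
  continuous df ->
  (forall e : R, 0 < e ->
    \forall h \near 0, `|f (h + x) - f x - df h| <= e * `|h|) ->
  differentiable f x.
Proof.
move=> dfc H.
have E : f \o shift x = cst (f x) + df +o_ (0 : V) id.
  apply/eqaddoP => e e0; near=> h.
  rewrite !fctE /= opprD addrA.
  by near: h; exact: H.
apply/diff_locallyP; rewrite (diff_unique dfc E); split => //.
Unshelve. all: by end_near. Qed.

Lemma near_eq_differentiable (R : numFieldType) (V W : normedModType R)
    (f g : V -> W) (x : V) :
  (\near x, f x = g x) -> differentiable f x -> differentiable g x.
Proof.
move=> fg df; apply: (@differentiable_linear_approx _ _ _ _ ('d f x)).
  exact: diff_continuous.
move=> e e0.
have /diff_locallyP[_ /eqaddoP/(_ e e0)] := df.
apply: filter_app.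
have : \forall h \near 0, f (h + x) = g (h + x).
  move: fg; rewrite (near_shift 0 x) /= => /filterS; apply => y.
  by rewrite /= subr0.
apply: filterS => h <-.
rewrite !fctE /= opprD addrA.
by rewrite (nbhs_singleton fg).
Qed.

Section SmoothGeneral.
Variables (R : realType) (n : nat) (W : normedModType R).
Implicit Types (U : set 'rV[R]_n) (f g : 'rV[R]_n -> W).

Lemma smooth_on_differentiable U f x :
  smooth_on U f -> U x -> differentiable f x.
Proof. by move=> sf Ux; exact: (sf [::]). Qed.

Lemma smooth_on_derive U f v : smooth_on U f -> smooth_on U ('D_v f).
Proof.
move=> sf vs x Ux; have := sf (rcons vs v) x Ux; rewrite foldr_rcons; exact.
Qed.

(** Smoothness truncated at order [k]. The recursion peels the innermost derivative, so that product
    and chain rules can be applied in an induction on [k] rather than on a list of directions. *)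
Fixpoint Cdiff (k : nat) U f : Prop :=
  (forall x, U x -> differentiable f x) /\
  if k is k'.+1 then forall v, Cdiff k' U ('D_v f) else True.

Lemma CdiffS k U f : Cdiff k.+1 U f -> Cdiff k U f.
Proof.
by elim: k f => [|k IH] f [df Df]; split => // v; exact/IH/Df.
Qed.

Lemma Cdiff_differentiable k U f x : Cdiff k U f -> U x -> differentiable f x.
Proof. by case: k => [|k] [+ _]; exact. Qed.

Lemma smooth_onP U f : smooth_on U f <-> forall k, Cdiff k U f.
Proof.
split=> [sf k|Cf vs].
  elim: k f sf => [|k IH] f sf; split => //.
  - by move=> x; exact: smooth_on_differentiable sf.
  - by move=> x; exact: smooth_on_differentiable sf.
  - by move=> v; apply/IH/smooth_on_derive.
have : Cdiff (size vs) U f by exact: Cf.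
(* The last direction of the list is the one that [foldr] applies first. *)
elim/last_ind: vs f {Cf} => [|vs v IH] f /=; first by case.
by rewrite size_rcons => -[_ Df] x Ux; rewrite foldr_rcons; exact: (IH _ (Df v)).
Qed.

Lemma open_near_eq U f g x : open U -> (forall y, U y -> f y = g y) -> U x ->
  \near x, f x = g x.
Proof.
move=> oU fg Ux; have : nbhs x U by exact: open_nbhs_nbhs.
by apply: filterS.
Qed.

Lemma open_eq_derive U f g v x : open U -> (forall y, U y -> f y = g y) -> U x ->
  'D_v f x = 'D_v g x.
Proof. by move=> oU fg Ux; apply: near_eq_derive; exact: open_near_eq Ux. Qed.

(** A derivative at a point depends only on the germ there, and openness of [U] turns equality on
    [U] into equality of germs. *)
Lemma eq_Cdiff k U f g : open U -> (forall y, U y -> f y = g y) ->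
  Cdiff k U f -> Cdiff k U g.
Proof.
move=> oU; elim: k f g => [|k IH] f g fg [df Df]; split => //.
- by move=> x Ux; apply: near_eq_differentiable (df x Ux); exact: open_near_eq Ux.
- by move=> x Ux; apply: near_eq_differentiable (df x Ux); exact: open_near_eq Ux.
- by move=> v; apply: IH (Df v) => y Uy; exact: open_eq_derive Uy.
Qed.

Lemma eq_smooth_on U f g : open U -> (forall y, U y -> f y = g y) ->
  smooth_on U f -> smooth_on U g.
Proof.
by move=> oU fg /smooth_onP sf; apply/smooth_onP => k; exact: eq_Cdiff (sf k).
Qed.

Lemma smooth_on_subset U V f : V `<=` U -> smooth_on U f -> smooth_on V f.
Proof. by move=> VU sf vs x /VU; exact: sf. Qed.

Lemma smooth_on_cst U (w : W) : smooth_on U (cst w).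
Proof.
apply/smooth_onP => k; elim: k w => [|k IH] w; split => //= v.
have -> : 'D_v (cst w) = cst (0 : W) by apply/funext => y; rewrite derive_cst.
exact: IH.
Qed.

Lemma Cdiff_add k U f g : open U ->
  Cdiff k U f -> Cdiff k U g -> Cdiff k U (f + g).
Proof.
move=> oU; elim: k f g => [|k IH] f g [df Df] [dg Dg].
  by split=> [x Ux|]; [apply: differentiableD; [exact: df|exact: dg]|].
split=> [x Ux|v]; first by apply: differentiableD; [exact: df|exact: dg].
apply: (eq_Cdiff oU) (IH _ _ (Df v) (Dg v)) => y Uy.
by rewrite deriveD //; apply: diff_derivable; [exact: df|exact: dg].
Qed.

Lemma smooth_onD U f g : open U ->
  smooth_on U f -> smooth_on U g -> smooth_on U (f + g).
Proof.
by move=> oU /smooth_onP sf /smooth_onP sg; apply/smooth_onP => k; exact: Cdiff_add.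
Qed.

End SmoothGeneral.

Section SmoothScalar.
Variables (R : realType) (n : nat).
Implicit Types (U : set 'rV[R]_n) (f g : 'rV[R]_n -> R^o).

Lemma Cdiff_mul k U f g : open U ->
  Cdiff k U f -> Cdiff k U g -> Cdiff k U (f * g : _ -> R^o).
Proof.
move=> oU; elim: k f g => [|k IH] f g Cf Cg.
  by split => // x Ux; apply: differentiableM;
    [exact: Cdiff_differentiable Cf Ux|exact: Cdiff_differentiable Cg Ux].
split=> [x Ux|v].
  by apply: differentiableM;
    [exact: Cdiff_differentiable Cf Ux|exact: Cdiff_differentiable Cg Ux].
have Cfv := Cf.2 v; have Cgv := Cg.2 v.
apply: (eq_Cdiff oU) (Cdiff_add oU (IH _ _ (CdiffS Cf) Cgv)
  (IH _ _ (CdiffS Cg) Cfv)) => y Uy.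
by rewrite deriveM //; apply: diff_derivable;
    [exact: Cdiff_differentiable Cf Uy|exact: Cdiff_differentiable Cg Uy].
Qed.

Lemma smooth_onM U f g : open U ->
  smooth_on U f -> smooth_on U g -> smooth_on U (f * g : _ -> R^o).
Proof.
by move=> oU /smooth_onP sf /smooth_onP sg; apply/smooth_onP => k; exact: Cdiff_mul.
Qed.

Lemma smooth_onN U f : open U -> smooth_on U f -> smooth_on U (- f).
Proof.
move=> oU sf; have := smooth_onM oU (@smooth_on_cst R n R^o U (-1)) sf.
by apply: eq_smooth_on => // y _; rewrite fctE /= mulN1r.
Qed.

Lemma smooth_on_sum (I : Type) (r : seq I) (P : pred I)
    (F : I -> 'rV[R]_n -> R^o) U : open U ->
  (forall i, P i -> smooth_on U (F i)) ->
  smooth_on U (fun x => \sum_(i <- r | P i) F i x : R^o).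
Proof.
move=> oU sF; have -> : (fun x => \sum_(i <- r | P i) F i x : R^o) =
    \sum_(i <- r | P i) F i by apply/funext => x; rewrite fct_sumE.
elim/big_ind : _ => //; [exact: (@smooth_on_cst R n R^o)|].
by move=> f g; exact: smooth_onD.
Qed.

Lemma smooth_onV U f : open U -> (forall x, U x -> f x != 0) ->
  smooth_on U f -> smooth_on U (fun x => (f x)^-1 : R^o).
Proof.
move=> oU f0 /smooth_onP sf; apply/smooth_onP => k.
have df x : U x -> differentiable f x by exact: Cdiff_differentiable (sf 0).
elim: k => [|k IH]; first by split=> // x Ux; apply: differentiableV; auto.
split=> [x Ux|v]; first by apply: differentiableV; auto.
have /smooth_onP sDf : smooth_on U ('D_v f) by apply: smooth_on_derive; apply/smooth_onP.
have /smooth_onP sm1 : smooth_on U (cst (-1) : _ -> R^o) by exact: smooth_on_cst.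
(* The derivative is -(D_v f) f^-1 f^-1, and the induction hypothesis covers both inverse
   factors. *)
apply: (eq_Cdiff oU) (Cdiff_mul oU (Cdiff_mul oU (sm1 k) (sDf k))
  (Cdiff_mul oU IH IH)) => y Uy.
rewrite deriveV; [|exact: f0|by apply: diff_derivable; exact: df].
rewrite !fctE /= mulN1r -invfM -expr2 mulNr [RHS]mulNr.
by rewrite mulrC.
Qed.

(* The cases of interest are the families {expR} and {sin, cos, - sin, - cos}, on which
   [d] sends an index to the index of the derivative. *)
Lemma smooth_on_comp1 (I : Type) (phi : I -> R -> R) (d : I -> I) U f :
  open U -> (forall i (x : R), is_derive x 1 (phi i) (phi (d i) x)) ->
  smooth_on U f -> forall i, smooth_on U (fun x => phi i (f x) : R^o).
Proof.
move=> oU dphi /smooth_onP sf i; apply/smooth_onP => k.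
have df x : U x -> differentiable f x by exact: Cdiff_differentiable (sf 0).
have dc j x : U x -> differentiable (fun x => phi j (f x) : R^o) x.
  move=> Ux; apply: (@differentiable_comp _ _ _ _ f (phi j : R -> R^o)); first exact: df.
  by apply/derivable1_diffP; exact: ex_derive.
elim: k i => [|k IH] i; first by split=> // x; exact: dc.
split=> [x|v]; first exact: dc.
have /smooth_onP sDf : smooth_on U ('D_v f) by apply: smooth_on_derive; apply/smooth_onP.
apply: (eq_Cdiff oU) (Cdiff_mul oU (sDf k) (IH (d i))) => y Uy.
rewrite deriveE; last exact: dc.
have dphiy : differentiable (phi i : R -> R^o) (f y).
  by apply/derivable1_diffP; exact: ex_derive.
rewrite (@diff_comp _ _ _ _ f (phi i : R -> R^o)) //; last exact: df.
rewrite /= deriv1E; last exact: ex_derive.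
rewrite derive1E derive_val. by rewrite -deriveE //; exact: df.
Qed.

End SmoothScalar.

Section SmoothMatrix.
Variables (R : realType) (n : nat).
Implicit Types (U : set 'rV[R]_n).

Lemma differentiable_entry p q (F : 'rV[R]_n -> 'M[R]_(p, q)) i j x :
  differentiable F x -> differentiable (fun y => F y i j : R^o) x.
Proof.
move=> dF; apply: (@differentiable_comp _ _ _ _ F
  (fun N : 'M[R]_(p, q) => N i j : R^o)) => //.
exact: differentiable_coord.
Qed.

Lemma derive_entry p q (F : 'rV[R]_n -> 'M[R]_(p, q)) i j v x :
  derivable F x v -> ('D_v F x) i j = 'D_v (fun y => F y i j : R^o) x.
Proof. by move=> dF; rewrite derive_mx // mxE. Qed.

Lemma smooth_on_entry p q (F : 'rV[R]_n -> 'M[R]_(p, q)) i j U : open U ->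
  smooth_on U F -> smooth_on U (fun y => F y i j : R^o).
Proof.
move=> oU /smooth_onP sF; apply/smooth_onP => k; have {sF} := sF k.
elim: k F => [|k IH] F [dF DF].
  by split=> // x Ux; exact/differentiable_entry/dF.
split=> [x Ux|v]; first exact/differentiable_entry/dF.
apply: (eq_Cdiff oU) (IH _ (DF v)) => y Uy.
by apply: derive_entry; apply: diff_derivable; exact: dF.
Qed.

Lemma derive_sum_coord (W : normedModType R) (f : 'rV[R]_n -> W) x v :
  differentiable f x ->
  'D_v f x = \sum_a v 0 a *: 'D_(delta_mx 0 a) f x.
Proof.
move=> df; rewrite deriveE // {1}(row_sum_delta v) linear_sum.
by apply: eq_bigr => a _; rewrite linearZ deriveE.
Qed.

End SmoothMatrix.

(** The chain rule writes a derivative of [f \o t] as a sum of products of components of the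
    derivative of [t] with partial derivatives of [f] composed with [t]; the induction on the order
    therefore runs over all [f] at once. *)
Lemma smooth_on_comp (R : realType) (p n : nat) (U : set 'rV[R]_p)
    (V : set 'rV[R]_n) (t : 'rV[R]_p -> 'rV[R]_n) (f : 'rV[R]_n -> R^o) :
  open U -> (forall x, U x -> V (t x)) -> smooth_on U t -> smooth_on V f ->
  smooth_on U (f \o t).
Proof.
move=> oU UV st /smooth_onP sf; apply/smooth_onP => k; have {sf} := sf k.
have dt x : U x -> differentiable t x by exact: smooth_on_differentiable st.
have dc g l x : Cdiff l V g -> U x -> differentiable (g \o t) x.
  move=> Cg Ux; apply: differentiable_comp; first exact: dt.
  by apply: Cdiff_differentiable Cg _; exact: UV.
elim: k f => [|k IH] f Cf; first by split=> // x; exact: dc Cf.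
split=> [x|v]; first exact: dc Cf.
have sDt a : smooth_on U (fun y => ('D_v t y) 0 a : R^o).
  by apply: smooth_on_entry => //; exact: smooth_on_derive.
have CD : Cdiff k U (\sum_a ((fun y => ('D_v t y) 0 a : R^o) *
    ('D_(delta_mx 0 a) f \o t : _ -> R^o)) : _ -> R^o).
  elim/big_ind : _ => [||a _].
  - by have /smooth_onP := @smooth_on_cst R p R^o U 0; exact.
  - by move=> g h; exact: Cdiff_add.
  - apply: Cdiff_mul => //; first by have /smooth_onP := sDt a; exact.
    by apply: IH; exact: Cf.2.
apply: (eq_Cdiff oU) CD => y Uy.
have dfy : differentiable f (t y) by apply: Cdiff_differentiable Cf _; exact: UV.
rewrite fct_sumE deriveE; last exact: dc Cf Uy.
rewrite diff_comp //=; last exact: dt.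
by rewrite -(deriveE _ (dt _ Uy)) -(deriveE _ dfy) (derive_sum_coord _ dfy).
Qed.

(** * Complex-valued functions *)

Lemma derive_comp1 (R : realType) (n : nat) (phi : R -> R) (d : R)
    (f : 'rV[R]_n -> R^o) x v : is_derive (f x : R) 1 phi d -> differentiable f x ->
  'D_v (phi \o f : _ -> R^o) x = d * 'D_v f x /\
  differentiable (phi \o f : _ -> R^o) x.
Proof.
move=> dphi df.
have dphix : differentiable (phi : R -> R^o) (f x).
  by apply/derivable1_diffP; exact: ex_derive.
have dc : differentiable (phi \o f : _ -> R^o) x by exact: differentiable_comp.
split => //; rewrite (deriveE _ dc) diff_comp //= deriv1E; last exact: ex_derive.
by rewrite derive1E derive_val mulrC -deriveE.
Qed.

Section ComplexCalculus.
Variables (R : realType) (n : nat).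
Local Notation C := R[i].
Implicit Types (U : set 'rV[R]_n) (f g : 'rV[R]_n -> C) (x v : 'rV[R]_n).

Definition re_fun f : 'rV[R]_n -> R^o := fun y => complex.Re (f y).
Definition im_fun f : 'rV[R]_n -> R^o := fun y => complex.Im (f y).

(** Real differentiability of both components; no holomorphy is meant. *)
Definition cdifferentiable f x :=
  differentiable (re_fun f) x /\ differentiable (im_fun f) x.

Definition cderive v f x : C := Complex ('D_v (re_fun f) x) ('D_v (im_fun f) x).

Definition csmooth_on U f := smooth_on U (re_fun f) /\ smooth_on U (im_fun f).

Lemma csmooth_on_differentiable U f x :
  csmooth_on U f -> U x -> cdifferentiable f x.
Proof.
by move=> [sr si] Ux; split; [exact: smooth_on_differentiable sr Ux|
  exact: smooth_on_differentiable si Ux].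
Qed.

Lemma csmooth_on_subset U V f : V `<=` U -> csmooth_on U f -> csmooth_on V f.
Proof. by move=> VU [sr si]; split; exact: smooth_on_subset VU _. Qed.

Lemma eq_csmooth_on U f g : open U -> (forall y, U y -> f y = g y) ->
  csmooth_on U f -> csmooth_on U g.
Proof.
move=> oU fg [sr si]; split.
  by apply: eq_smooth_on sr => // y Uy; rewrite /re_fun fg.
by apply: eq_smooth_on si => // y Uy; rewrite /im_fun fg.
Qed.

Lemma open_eq_cderive U f g v x : open U -> (forall y, U y -> f y = g y) ->
  U x -> cderive v f x = cderive v g x.
Proof.
move=> oU fg Ux; congr Complex; apply: (open_eq_derive _ oU _ Ux) => y Uy.
  by rewrite /re_fun fg.
by rewrite /im_fun fg.
Qed.

Lemma cderive_cst v (c : C) x : cderive v (cst c) x = 0.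
Proof.
have -> : cderive v (cst c) x = Complex 0 0 by congr Complex; rewrite derive_cst.
by [].
Qed.

Lemma csmooth_on_cst U (c : C) : csmooth_on U (cst c).
Proof. by split; exact: smooth_on_cst. Qed.

Lemma cdifferentiable_cst (c : C) x : cdifferentiable (cst c) x.
Proof. by split; exact: differentiable_cst. Qed.

Lemma re_funD f g : re_fun (fun y => f y + g y) = re_fun f + re_fun g.
Proof. by apply/funext => y; rewrite /re_fun !fctE; case: (f y) (g y) => [? ?] []. Qed.

Lemma im_funD f g : im_fun (fun y => f y + g y) = im_fun f + im_fun g.
Proof. by apply/funext => y; rewrite /im_fun !fctE; case: (f y) (g y) => [? ?] []. Qed.

Lemma re_funM f g :
  re_fun (fun y => f y * g y) = re_fun f * re_fun g - im_fun f * im_fun g.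
Proof.
by apply/funext => y; rewrite /re_fun /im_fun !fctE; case: (f y) (g y) => [? ?] [].
Qed.

Lemma im_funM f g :
  im_fun (fun y => f y * g y) = re_fun f * im_fun g + im_fun f * re_fun g.
Proof.
by apply/funext => y; rewrite /re_fun /im_fun !fctE; case: (f y) (g y) => [? ?] [].
Qed.

Lemma cdifferentiableD f g x : cdifferentiable f x -> cdifferentiable g x ->
  cdifferentiable (fun y => f y + g y) x.
Proof.
move=> [fr fi] [gr gi]; split; rewrite ?re_funD ?im_funD; exact: differentiableD.
Qed.

Lemma cderiveD v f g x : cdifferentiable f x -> cdifferentiable g x ->
  cderive v (fun y => f y + g y) x = cderive v f x + cderive v g x.
Proof.
move=> [fr fi] [gr gi]; rewrite /cderive re_funD im_funD.
by rewrite !deriveD; try exact: diff_derivable.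
Qed.

Lemma cderiveB v f g x : cdifferentiable f x -> cdifferentiable g x ->
  cderive v (fun y => f y - g y) x = cderive v f x - cderive v g x.
Proof.
move=> [fr fi] [gr gi]; rewrite /cderive.
have -> : re_fun (fun y => f y - g y) = re_fun f - re_fun g.
  by apply/funext => y; rewrite /re_fun !fctE; case: (f y) (g y) => [? ?] [].
have -> : im_fun (fun y => f y - g y) = im_fun f - im_fun g.
  by apply/funext => y; rewrite /im_fun !fctE; case: (f y) (g y) => [? ?] [].
by rewrite !deriveB; try exact: diff_derivable.
Qed.

Lemma csmooth_onD U f g : open U -> csmooth_on U f -> csmooth_on U g ->
  csmooth_on U (fun y => f y + g y).
Proof.
move=> oU [fr fi] [gr gi]; split; rewrite ?re_funD ?im_funD; exact: smooth_onD.
Qed.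

Lemma cdifferentiableM f g x : cdifferentiable f x -> cdifferentiable g x ->
  cdifferentiable (fun y => f y * g y) x.
Proof.
move=> [fr fi] [gr gi]; split; rewrite ?re_funM ?im_funM.
  by apply: differentiableB; exact: differentiableM.
by apply: differentiableD; exact: differentiableM.
Qed.

Lemma cderiveM v f g x : cdifferentiable f x -> cdifferentiable g x ->
  cderive v (fun y => f y * g y) x = cderive v f x * g x + f x * cderive v g x.
Proof.
move=> [fr fi] [gr gi]; rewrite /cderive re_funM im_funM.
have [drf dif] := (@diff_derivable _ _ _ _ _ v fr, @diff_derivable _ _ _ _ _ v fi).
have [drg dig] := (@diff_derivable _ _ _ _ _ v gr, @diff_derivable _ _ _ _ _ v gi).
rewrite (deriveB (derivableM drf drg) (derivableM dif dig)).
rewrite (deriveD (derivableM drf dig) (derivableM dif drg)).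
rewrite (deriveM drf drg) (deriveM dif dig) (deriveM drf dig) (deriveM dif drg).
move: ('D_v (re_fun f) x) ('D_v (re_fun g) x) => p q.
move: ('D_v (im_fun f) x) ('D_v (im_fun g) x) => r s.
rewrite /re_fun /im_fun; case: (f x) (g x) => [a b] [c d].
apply/eqP; rewrite eq_complex; apply/andP; split; apply/eqP => /=.
  by rewrite /GRing.scale /=; ring.
by rewrite /GRing.scale /=; ring.
Qed.

Lemma csmooth_onM U f g : open U -> csmooth_on U f -> csmooth_on U g ->
  csmooth_on U (fun y => f y * g y).
Proof.
move=> oU [fr fi] [gr gi]; split; rewrite ?re_funM ?im_funM.
  apply: smooth_onD => //; first exact: smooth_onM.
  by apply: smooth_onN => //; exact: smooth_onM.
by apply: smooth_onD => //; exact: smooth_onM.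
Qed.

Section BigOps.
Variables (I : Type) (r : seq I) (P : pred I) (F : I -> 'rV[R]_n -> C).

Lemma cdifferentiable_sum x : (forall i, P i -> cdifferentiable (F i) x) ->
  cdifferentiable (fun y => \sum_(i <- r | P i) F i y) x.
Proof.
move=> dF; rewrite -fct_sumE.
elim/big_ind : _ => //; first exact: cdifferentiable_cst.
by move=> f g; exact: cdifferentiableD.
Qed.

Lemma cderive_sum v x : (forall i, P i -> cdifferentiable (F i) x) ->
  cderive v (fun y => \sum_(i <- r | P i) F i y) x =
  \sum_(i <- r | P i) cderive v (F i) x.
Proof.
move=> dF; rewrite -fct_sumE.
pose K (f : 'rV[R]_n -> C) (c : C) := cdifferentiable f x /\ cderive v f x = c.
suff : K (\sum_(i <- r | P i) F i) (\sum_(i <- r | P i) cderive v (F i) x) by case.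
elim/big_ind2 : _ => [|f a g b [df <-] [dg <-]|i Pi].
- by split; [exact: cdifferentiable_cst|exact: cderive_cst].
- by split; [exact: cdifferentiableD|exact: cderiveD].
- by split => //; exact: dF.
Qed.

Lemma csmooth_on_sum U : open U -> (forall i, P i -> csmooth_on U (F i)) ->
  csmooth_on U (fun y => \sum_(i <- r | P i) F i y).
Proof.
move=> oU sF; rewrite -fct_sumE.
elim/big_ind : _ => //; first exact: csmooth_on_cst.
by move=> f g; exact: csmooth_onD.
Qed.

Lemma cdifferentiable_prod x : (forall i, P i -> cdifferentiable (F i) x) ->
  cdifferentiable (fun y => \prod_(i <- r | P i) F i y) x.
Proof.
move=> dF; rewrite -fct_prodE.
elim/big_ind : _ => //; first exact: cdifferentiable_cst.
by move=> f g; exact: cdifferentiableM.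
Qed.

Lemma csmooth_on_prod U : open U -> (forall i, P i -> csmooth_on U (F i)) ->
  csmooth_on U (fun y => \prod_(i <- r | P i) F i y).
Proof.
move=> oU sF; rewrite -fct_prodE.
elim/big_ind : _ => //; first exact: csmooth_on_cst.
by move=> f g; exact: csmooth_onM.
Qed.

End BigOps.

Lemma cderive_prod m (F : 'I_m -> 'rV[R]_n -> C) v x :
  (forall i, cdifferentiable (F i) x) ->
  cderive v (fun y => \prod_i F i y) x =
  \sum_a \prod_i (if i == a then cderive v (F i) x else F i x).
Proof.
elim: m F => [|m IH] F dF.
  rewrite big_ord0; under [X in cderive v X]eq_fun do rewrite big_ord0.
  exact: cderive_cst.
under [X in cderive v X]eq_fun do rewrite big_ord_recl.
rewrite cderiveM; [|exact: dF|by apply: cdifferentiable_prod].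
rewrite IH // big_ord_recl big_ord_recl eqxx; congr (_ + _).
rewrite mulr_sumr; apply: eq_bigr => a _.
by rewrite big_ord_recl /=; congr (_ * _).
Qed.

Lemma csmooth_on_real U (f : 'rV[R]_n -> R^o) : smooth_on U f ->
  csmooth_on U (fun y => (f y)%:C%C).
Proof. by move=> sf; split => //; exact: (@smooth_on_cst R n R^o). Qed.

Lemma cderive_real (f : 'rV[R]_n -> R^o) v x :
  cderive v (fun y => (f y)%:C%C) x = ('D_v f x)%:C%C.
Proof. by congr Complex; rewrite [LHS](@derive_cst _ _ R^o). Qed.

(** Written in components, the form that [cderive] can differentiate. What matters below is that it
    has no zero and reproduces itself under differentiation. *)
Definition cexp (c : C) : C :=
  Complex (expR (complex.Re c) * cos (complex.Im c))
          (expR (complex.Re c) * sin (complex.Im c)).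

Lemma cexp_neq0 c : cexp c != 0.
Proof.
case: c => a b; rewrite eq_complex /= !mulf_eq0 (gt_eqF (expR_gt0 a)) /=.
apply/negP => /andP [/eqP cb /eqP sb]; have := cos2Dsin2 b.
by rewrite cb sb !expr0n addr0 => /eqP; rewrite eq_sym oner_eq0.
Qed.

(** The inverse is the conjugate divided by the squared modulus, so the real case applies to re^2 +
    im^2. *)
Lemma csmooth_on_V U f : open U -> (forall x, U x -> f x != 0) ->
  csmooth_on U f -> csmooth_on U (fun y => (f y)^-1).
Proof.
move=> oU f0 [fr fi].
have sN : smooth_on U (re_fun f * re_fun f + im_fun f * im_fun f : _ -> R^o).
  by apply: smooth_onD => //; exact: smooth_onM.
have N0 x : U x -> (re_fun f * re_fun f + im_fun f * im_fun f : _ -> R^o) x != 0.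
  move=> Ux; rewrite fctE paddr_eq0 ?mulf_eq0 ?orbb; try exact: sqr_ge0.
  by have := f0 x Ux; rewrite eq_complex.
have sV := smooth_onV oU N0 sN.
split.
  apply: (eq_smooth_on oU) (smooth_onM oU fr sV) => y Uy.
  by rewrite /re_fun /im_fun !fctE; case: (f y) => a b /=; rewrite -!expr2.
apply: (eq_smooth_on oU) (smooth_onN oU (smooth_onM oU fi sV)) => y Uy.
by rewrite /re_fun /im_fun !fctE; case: (f y) => a b /=; rewrite -!expr2.
Qed.

Lemma smooth_on_expR U (f : 'rV[R]_n -> R^o) : open U -> smooth_on U f ->
  smooth_on U (fun y => expR (f y) : R^o).
Proof.
move=> oU sf; apply: (@smooth_on_comp1 _ _ unit (fun=> expR) id U f oU _ sf tt).
Qed.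

Lemma smooth_on_cos_sin U (f : 'rV[R]_n -> R^o) : open U -> smooth_on U f ->
  smooth_on U (fun y => cos (f y) : R^o) /\ smooth_on U (fun y => sin (f y) : R^o).
Proof.
move=> oU sf.
(* The first bit selects cos over sin and the second is the sign. Differentiation flips the first
   bit, and changes the sign exactly when it starts from a cosine. *)
pose phi (b : bool * bool) : R -> R :=
  match b with (false, false) => sin | (true, false) => cos
  | (false, true) => - sin | (true, true) => - cos end.
pose d (b : bool * bool) := (~~ b.1, b.1 (+) b.2).
have H := @smooth_on_comp1 _ _ _ phi d U f oU _ sf.
split; [apply: (H _ (true, false))|apply: (H _ (false, false))];
  move=> [[] []] y /=; apply: is_derive_eq; rewrite ?fctE ?opprK //.
Qed.

Lemma csmooth_on_cexp U f : open U -> csmooth_on U f ->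
  csmooth_on U (fun y => cexp (f y)).
Proof.
move=> oU [fr fi]; have sE := smooth_on_expR oU fr.
have [sc ss] := smooth_on_cos_sin oU fi.
by split; exact: smooth_onM.
Qed.

Lemma cdifferentiable_cexp f x : cdifferentiable f x ->
  cdifferentiable (fun y => cexp (f y)) x.
Proof.
move=> [df di].
have [_ dE] := derive_comp1 x (is_derive_expR (re_fun f x)) df.
have [_ dC] := derive_comp1 x (is_derive_cos (im_fun f x)) di.
have [_ dS] := derive_comp1 x (is_derive_sin (im_fun f x)) di.
by split; [exact: (differentiableM dE dC)|exact: (differentiableM dE dS)].
Qed.

Lemma cderive_cexp v f x : cdifferentiable f x ->
  cderive v (fun y => cexp (f y)) x = cexp (f x) * cderive v f x.
Proof.
move=> [df di]; pose re := re_fun f; pose im := im_fun f.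
have [De dE] := derive_comp1 v (is_derive_expR (re x)) df.
have [Dc dC] := derive_comp1 v (is_derive_cos (im x)) di.
have [Ds dS] := derive_comp1 v (is_derive_sin (im x)) di.
rewrite /cderive.
have -> : re_fun (fun y => cexp (f y)) = (expR \o re) * (cos \o im) by [].
have -> : im_fun (fun y => cexp (f y)) = (expR \o re) * (sin \o im) by [].
have aux (g : 'rV[R]_n -> R^o) : differentiable g x -> derivable g x v.
  by move=> dg; exact: diff_derivable.
rewrite (deriveM (aux _ dE) (aux _ dC)) (deriveM (aux _ dE) (aux _ dS)).
rewrite De Dc Ds /re /im.
move: ('D_v (re_fun f) x) ('D_v (im_fun f) x) => p q.
apply/eqP; rewrite eq_complex /cexp -/(re_fun f x) -/(im_fun f x).
by apply/andP; split; apply/eqP; rewrite /GRing.scale /=; ring.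
Qed.

End ComplexCalculus.

(** * Matrix-valued maps, determinants and inverses *)

Section MatrixCalculus.
Variables (R : realType) (n : nat).
Local Notation C := R[i].
Implicit Types (U : set 'rV[R]_n) (x v : 'rV[R]_n).

Definition mx_differentiable p q (F : 'rV[R]_n -> 'M[C]_(p, q)) x :=
  forall i j, cdifferentiable (fun y => F y i j) x.

Definition mx_derive p q v (F : 'rV[R]_n -> 'M[C]_(p, q)) x : 'M[C]_(p, q) :=
  \matrix_(i, j) cderive v (fun y => F y i j) x.

Definition mx_smooth_on p q U (F : 'rV[R]_n -> 'M[C]_(p, q)) :=
  forall i j, csmooth_on U (fun y => F y i j).

Lemma mx_smooth_on_differentiable p q U (F : 'rV[R]_n -> 'M[C]_(p, q)) x :
  mx_smooth_on U F -> U x -> mx_differentiable F x.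
Proof. by move=> sF Ux i j; exact: csmooth_on_differentiable Ux. Qed.

Lemma open_eq_mx_derive p q U (F G : 'rV[R]_n -> 'M[C]_(p, q)) v x : open U ->
  (forall y, U y -> F y = G y) -> U x -> mx_derive v F x = mx_derive v G x.
Proof.
move=> oU FG Ux; apply/matrixP => i j; rewrite !mxE.
by apply: (open_eq_cderive _ oU) => // y Uy; rewrite FG.
Qed.

Lemma mx_smooth_on_subset p q U V (F : 'rV[R]_n -> 'M[C]_(p, q)) :
  V `<=` U -> mx_smooth_on U F -> mx_smooth_on V F.
Proof. by move=> VU sF i j; exact: csmooth_on_subset VU _. Qed.

Lemma mx_derive_cst p q (A : 'M[C]_(p, q)) v x : mx_derive v (cst A) x = 0.
Proof. by apply/matrixP => i j; rewrite !mxE [LHS]cderive_cst. Qed.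

Lemma mx_differentiable_cst p q (A : 'M[C]_(p, q)) x : mx_differentiable (cst A) x.
Proof. by move=> i j; exact: cdifferentiable_cst. Qed.

Lemma mx_smooth_on_cst p q U (A : 'M[C]_(p, q)) : mx_smooth_on U (cst A).
Proof. by move=> i j; exact: csmooth_on_cst. Qed.

Lemma mx_differentiableM p q r (F : 'rV[R]_n -> 'M[C]_(p, q))
    (G : 'rV[R]_n -> 'M[C]_(q, r)) x :
  mx_differentiable F x -> mx_differentiable G x ->
  mx_differentiable (fun y => F y *m G y) x.
Proof.
move=> dF dG i j; under eq_fun do rewrite mxE.
by apply: cdifferentiable_sum => k _; exact: cdifferentiableM.
Qed.

Lemma mx_deriveM p q r (F : 'rV[R]_n -> 'M[C]_(p, q))
    (G : 'rV[R]_n -> 'M[C]_(q, r)) v x :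
  mx_differentiable F x -> mx_differentiable G x ->
  mx_derive v (fun y => F y *m G y) x =
  mx_derive v F x *m G x + F x *m mx_derive v G x.
Proof.
move=> dF dG; apply/matrixP => i j; rewrite !mxE.
under [X in cderive v X]eq_fun do rewrite mxE.
rewrite cderive_sum => [|k _]; last exact: cdifferentiableM.
rewrite -big_split; apply: eq_bigr => k _ /=.
by rewrite cderiveM // !mxE.
Qed.

Lemma mx_deriveB p q (F G : 'rV[R]_n -> 'M[C]_(p, q)) v x :
  mx_differentiable F x -> mx_differentiable G x ->
  mx_derive v (fun y => F y - G y) x = mx_derive v F x - mx_derive v G x.
Proof.
move=> dF dG; apply/matrixP => i j; rewrite !mxE.
have -> : (fun y => (F y - G y) i j) = (fun y => F y i j - G y i j).
  by apply/funext => y; rewrite !mxE.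
exact: cderiveB.
Qed.

Lemma mx_smooth_onM p q r (F : 'rV[R]_n -> 'M[C]_(p, q))
    (G : 'rV[R]_n -> 'M[C]_(q, r)) U : open U ->
  mx_smooth_on U F -> mx_smooth_on U G -> mx_smooth_on U (fun y => F y *m G y).
Proof.
move=> oU sF sG i j; have -> : (fun y => (F y *m G y) i j) =
    (fun y => \sum_k F y i k * G y k j) by apply/funext => y; rewrite mxE.
by apply: csmooth_on_sum => // k _; exact: csmooth_onM.
Qed.

Lemma cderive_trace p (F : 'rV[R]_n -> 'M[C]_p) v x : mx_differentiable F x ->
  cderive v (fun y => \tr (F y)) x = \tr (mx_derive v F x).
Proof.
move=> dF; rewrite cderive_sum => [|k _]; last exact: dF.
by apply: eq_bigr => k _; rewrite mxE.
Qed.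

Definition complexify p q (A : 'M[R]_(p, q)) : 'M[C]_(p, q) :=
  map_mx (real_complex R) A.

Lemma complexifyM p q r (A : 'M[R]_(p, q)) (B : 'M[R]_(q, r)) :
  complexify (A *m B) = complexify A *m complexify B.
Proof. exact: map_mxM. Qed.

Lemma complexify_inj p q : injective (@complexify p q).
Proof.
by move=> A B /matrixP AB; apply/matrixP => i j; have := AB i j; rewrite !mxE => -[].
Qed.

Lemma complexifyB p q (A B : 'M[R]_(p, q)) :
  complexify (A - B) = complexify A - complexify B.
Proof. exact: map_mxB. Qed.

Lemma complexifyD p q (A B : 'M[R]_(p, q)) :
  complexify (A + B) = complexify A + complexify B.
Proof. exact: map_mxD. Qed.

Lemma mx_derive_real p q (F : 'rV[R]_n -> 'M[R]_(p, q)) v x :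
  (forall i j, differentiable (fun y => F y i j : R^o) x) ->
  mx_derive v (fun y => complexify (F y)) x = complexify ('D_v F x).
Proof.
move=> dF; rewrite derive_mx; last first.
  by apply/derivable_mxP => i j; apply: diff_derivable; exact: dF.
apply/matrixP => i j; rewrite !mxE -cderive_real; congr (cderive _ _ _).
by apply/funext => y; rewrite mxE.
Qed.

Lemma mx_smooth_on_real p q U (F : 'rV[R]_n -> 'M[R]_(p, q)) :
  (forall i j, smooth_on U (fun y => F y i j : R^o)) ->
  mx_smooth_on U (fun y => complexify (F y)).
Proof.
move=> sF i j; have -> : (fun y => complexify (F y) i j) =
    (fun y => (F y i j)%:C%C) by apply/funext => y; rewrite mxE.
exact: csmooth_on_real.
Qed.

Lemma csmooth_on_det p U (F : 'rV[R]_n -> 'M[C]_p) : open U ->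
  mx_smooth_on U F -> csmooth_on U (fun y => \det (F y)).
Proof.
move=> oU sF; apply: csmooth_on_sum => // s _.
apply: csmooth_onM => //; first exact: csmooth_on_cst.
by apply: csmooth_on_prod => // i _; exact: sF.
Qed.

Lemma cdifferentiable_det p (F : 'rV[R]_n -> 'M[C]_p) x :
  mx_differentiable F x -> cdifferentiable (fun y => \det (F y)) x.
Proof.
move=> dF; apply: cdifferentiable_sum => s _.
apply: cdifferentiableM; first exact: cdifferentiable_cst.
by apply: cdifferentiable_prod => i _; exact: dF.
Qed.

Lemma mx_smooth_on_inv p U (F : 'rV[R]_n -> 'M[C]_p) : open U ->
  mx_smooth_on U F -> (forall x, U x -> \det (F x) != 0) ->
  mx_smooth_on U (fun y => invmx (F y)).
Proof.
move=> oU sF F0 i j; have sD := csmooth_on_det oU sF.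
have sV := csmooth_on_V oU F0 sD.
(* Cramer's rule: the entries are cofactors divided by the determinant. *)
apply: (eq_csmooth_on oU (f := fun y => (\det (F y))^-1 * cofactor (F y) j i)).
  by move=> y Uy; rewrite /invmx unitmxE unitfE F0 // !mxE.
apply: csmooth_onM => //; apply: csmooth_onM => //; first exact: csmooth_on_cst.
apply: csmooth_on_det => // a b.
have -> : (fun y => (row' j (col' i (F y))) a b) =
    (fun y => F y (lift j a) (lift i b)) by apply/funext => y; rewrite !mxE.
exact: sF.
Qed.

End MatrixCalculus.

(** Expansion along row [a]: the cofactors of that row do not see it, so they are those of [M]. *)
Lemma det_replace_row (F : comPzRingType) m (M : 'M[F]_m) a (w : 'rV[F]_m) :
  \det (\matrix_(i, j) (if i == a then w 0 j else M i j)) = (w *m \adj M) 0 a.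
Proof.
rewrite (expand_det_row _ a) mxE; apply: eq_bigr => j _.
rewrite !mxE eqxx; congr (_ * (_ * \det _)).
apply/matrixP => b c; rewrite !mxE.
by rewrite -[lift a b == a]negbK eq_sym neq_lift.
Qed.

(* Jacobi's formula *)
Lemma cderive_det (R : realType) n p (F : 'rV[R]_n -> 'M[R[i]]_p) v x :
  mx_differentiable F x ->
  cderive v (fun y => \det (F y)) x = \tr (mx_derive v F x *m \adj (F x)).
Proof.
move=> dF; rewrite /determinant.
have dP (s : 'S_p) : cdifferentiable (fun y => \prod_i F y i (s i)) x.
  by apply: cdifferentiable_prod => i _; exact: dF.
have dc (c : R[i]) : cdifferentiable (fun=> c : R[i]) x by exact: cdifferentiable_cst.
rewrite cderive_sum => [|s _]; last exact: cdifferentiableM.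
under eq_bigr => s _.
  rewrite cderiveM // [cderive v (fun=> _) x]cderive_cst mul0r add0r.
  rewrite (cderive_prod _ (fun i => dF i (s i))) mulr_sumr.
  over.
(* For fixed [a], the signed sum over permutations is the determinant with row [a] replaced by its
   derivative. *)
rewrite exchange_big; apply: eq_bigr => a _ /=.
transitivity ((row a (mx_derive v F x) *m \adj (F x)) 0 a); last first.
  by rewrite -row_mul mxE.
rewrite -det_replace_row; apply: eq_bigr => s _; congr (_ * _).
by apply: eq_bigr => i _; rewrite !mxE; case: eqP => // ->.
Qed.

(** * The theorem of Schwarz and the Poincare lemma *)

Section Lines.
Variables (R : realType) (n : nat).
Implicit Types (U : set 'rV[R]_n) (f : 'rV[R]_n -> R^o) (x u v : 'rV[R]_n).

Lemma is_derive_line f x u (s : R) : derivable f (x + s *: u) u ->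
  is_derive (s : R) (1 : R) (fun s : R => f (x + s *: u) : R) ('D_u f (x + s *: u)).
Proof.
move=> dfu.
have E : (fun h : R => h^-1 *: (((fun s : R => f (x + s *: u) : R) \o shift s) (h *: (1 : R))
      - f (x + s *: u))) =
    (fun h => h^-1 *: ((f \o shift (x + s *: u)) (h *: u) - f (x + s *: u))).
  apply/funext => h; congr (_ *: (f _ - _)) => /=.
  by rewrite [h%:A]mulr1 scalerDl addrCA.
by apply: DeriveDef; rewrite /derivable /derive E.
Qed.

Lemma mean_value_line f x u (h : R) : 0 <= h ->
  (forall s : R, 0 <= s <= h -> derivable f (x + s *: u) u) ->
  exists2 s : R, 0 <= s <= h & f (x + h *: u) - f x = h * 'D_u f (x + s *: u).
Proof.
move=> h0 df.
have D s : s \in `[0, h]%R ->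
    is_derive (s : R) (1 : R) (fun s : R => f (x + s *: u) : R) ('D_u f (x + s *: u)).
  by rewrite in_itv /= => /df; exact: is_derive_line.
pose g : R -> R := fun s => f (x + s *: u).
have Dg (s : R) : s \in `]0, h[ -> is_derive s (1 : R) g ('D_u f (x + s *: u)).
  by rewrite in_itv /= => /andP[s0 sh]; apply: D; rewrite in_itv /= !ltW.
have cg : {within `[0, h], continuous g}.
  apply: (@derivable_within_continuous R R g `[0, h]) => s sh.
  exact: (@ex_derive _ _ _ _ _ _ _ (D s sh)).
have [s] := @MVT_segment R g (fun s => 'D_u f (x + s *: u)) 0 h h0 Dg cg.
rewrite in_itv /= => sh E; exists s => //.
by move: E; rewrite /g subr0 scale0r addr0 mulrC.
Qed.

Lemma derive_shiftr f c y u :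
  'D_u (fun y => f (y + c) : R^o) y = 'D_u f (y + c).
Proof.
rewrite /derive.
suff -> : (fun h : R =>
    h^-1 *: (((fun y => f (y + c) : R^o) \o shift y) (h *: u) - f (y + c))) =
  (fun h => h^-1 *: ((f \o shift (y + c)) (h *: u) - f (y + c))) by [].
by apply/funext => h /=; rewrite addrA.
Qed.

Lemma differentiable_shiftr f c y : differentiable f (y + c) ->
  differentiable (fun y => f (y + c) : R^o) y.
Proof.
move=> df; apply: (@differentiable_comp _ _ _ _ (fun y => y + c) f) => //.
Qed.

(** The mean value theorem is used twice: along [u] for the increment of [f] by [h *: v], then along
    [v] for the derivative of [f] in the direction [u]. *)
Lemma second_difference U f x u v (h : R) : open U -> smooth_on U f -> 0 < h ->
  (forall a b : R, 0 <= a <= h -> 0 <= b <= h -> U (x + a *: u + b *: v)) ->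
  exists a b : R, [/\ 0 <= a <= h, 0 <= b <= h &
    f (x + h *: u + h *: v) - f (x + h *: u) - f (x + h *: v) + f x =
    h * (h * 'D_v ('D_u f) (x + a *: u + b *: v))].
Proof.
move=> oU sf h0 inU.
have hh : (0 : R) <= h <= h by rewrite lexx ltW.
have z0 : (0 : R) <= 0 <= h by rewrite lexx ltW.
have df y : U y -> differentiable f y by exact: smooth_on_differentiable.
have inU0 (a : R) : 0 <= a <= h -> U (x + a *: u).
  by move=> ah; have := inU a 0 ah z0; rewrite scale0r addr0.
have dg a : 0 <= a <= h ->
    differentiable (fun y => f (y + h *: v) : R^o) (x + a *: u).
  by move=> ah; apply/differentiable_shiftr/df; exact: inU.
have dfu a : 0 <= a <= h -> differentiable f (x + a *: u).
  by move=> ah; exact/df/inU0.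
have [a ah Ea] := @mean_value_line
  ((fun y => f (y + h *: v)) - f : _ -> R^o) x u h (ltW h0)
  (fun s sh => diff_derivable (differentiableB (dg s sh) (dfu s sh))).
have sDf : smooth_on U ('D_u f) by exact: smooth_on_derive.
have dDf b : 0 <= b <= h -> derivable ('D_u f) (x + a *: u + b *: v) v.
  by move=> bh; apply: diff_derivable; apply: smooth_on_differentiable sDf _; exact: inU.
have [b bh Eb] := mean_value_line (ltW h0) dDf.
exists a, b; split => //; rewrite -Eb.
move: Ea; rewrite deriveB; [|exact: diff_derivable (dg _ ah)|exact: diff_derivable (dfu _ ah)].
by rewrite derive_shiftr !fctE => <-; rewrite opprB addrA addrAC.
Qed.

(** If the mixed derivatives differed at [x], continuity would keep each of them, on a small ball,
    within half of the gap from its value at [x]; but the symmetry of the second difference makes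
    them take a common value on that ball. *)
Lemma smooth_on_schwarz U f u v x : open U -> smooth_on U f -> U x ->
  'D_u ('D_v f) x = 'D_v ('D_u f) x.
Proof.
have tri (p q c e : R) : `|p - c| < e -> `|q - c| < e -> `|p - q| < e + e.
  move=> pc qc; rewrite -(subrKA c); apply: le_lt_trans (ler_normD _ _) _.
  by apply: ltrD; [exact: pc|rewrite distrC; exact: qc].
move=> oU sf Ux; apply/eqP; apply: contraT => neq.
pose A := 'D_v ('D_u f); pose B := 'D_u ('D_v f).
pose e := `|B x - A x| / 2.
have e0 : 0 < e by rewrite divr_gt0 // normr_gt0 subr_eq0.
have cA : {for x, continuous A}.
  apply: differentiable_continuous; apply: smooth_on_differentiable Ux.
  by do 2 apply: smooth_on_derive.
have cB : {for x, continuous B}.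
  apply: differentiable_continuous; apply: smooth_on_differentiable Ux.
  by do 2 apply: smooth_on_derive.
have nU : \forall y \near x, U y by exact: open_nbhs_nbhs.
have nA : \forall y \near x, `|A x - A y| < e by exact: (@cvgr_dist_lt _ R _ _ _ A _ cA).
have nB : \forall y \near x, `|B x - B y| < e by exact: (@cvgr_dist_lt _ R _ _ _ B _ cB).
have [r /= r0 rN] := (nbhs_ballP _ _).1 (filterI nU (filterI nA nB)).
(* This gives h (|u| + |v|) < r, so the whole parallelogram lies in the ball; the added 1 covers u =
   v = 0. *)
pose h := r / (`|u| + `|v| + 1).
have d0 : 0 < `|u| + `|v| + 1 by rewrite ltr_wpDl // addr_ge0.
have h0 : 0 < h by rewrite divr_gt0.
(* Stated for a second pair of vectors so that it serves both orders of [u] and [v]. *)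
have inN u' v' : `|u'| + `|v'| = `|u| + `|v| -> forall a b, 0 <= a <= h -> 0 <= b <= h ->
    ball x r (x + a *: u' + b *: v').
  move=> E a b /andP[a0 ah] /andP[b0 bh].
  rewrite -ball_normE /ball_ /= -addrA opprD addNKr normrN.
  apply: le_lt_trans (ler_normD _ _) _; rewrite !normrZ !ger0_norm //.
  apply: (@le_lt_trans _ _ (h * (`|u| + `|v|))).
    by rewrite -E mulrDr lerD // ler_wpM2r.
  by rewrite /h mulrAC ltr_pdivrMr // ltr_pM2l // ltrDl.
have E1 := inN u v erefl.
have E2 := inN v u (addrC _ _).
have [a [b [ah bh Eab]]] := second_difference oU sf h0
  (fun a b ah bh => (rN _ (E1 a b ah bh)).1).
have [c [d [ch dh Ecd]]] := second_difference oU sf h0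
  (fun a b ah bh => (rN _ (E2 a b ah bh)).1).
(* The second difference is unchanged when [u] and [v] are exchanged; the factor h^2 is then
   cancelled. *)
have Epq : A (x + a *: u + b *: v) = B (x + c *: v + d *: u).
  apply: (mulfI (lt0r_neq0 h0)); apply: (mulfI (lt0r_neq0 h0)).
  apply: etrans (esym Eab) (etrans _ Ecd).
  by rewrite [x + h *: u + h *: v]addrAC; congr (_ + _); exact: addrAC.
have [_ [Ap _]] := rN _ (E1 a b ah bh).
have [_ [_ Bq]] := rN _ (E2 c d ch dh).
rewrite -Epq in Bq; have := tri _ _ _ _ Bq Ap.
by rewrite /e -splitr ltxx.
Qed.

End Lines.

(** * Fundamental theorem of calculus and differentiation under the integral sign *)

Section Leibniz.
Variable R : realType.
Local Notation mu := (@lebesgue_measure R).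

Lemma Rintegral_derive (f F : R -> R) :
  (forall t : R, 0 <= t <= 1 -> is_derive t (1 : R) F (f t)) ->
  {within `[(0 : R), 1], continuous f} ->
  \int[mu]_(t in `[0, 1]) f t = F 1 - F 0.
Proof.
move=> dF cf.
have cF (t : R) : 0 <= t <= 1 -> {for t, continuous F}.
  move=> t01; apply/differentiable_continuous/derivable1_diffP.
  exact: (@ex_derive _ _ _ _ _ _ _ (dF t t01)).
rewrite /Rintegral (@continuous_FTC2 _ f F 0 1) //.
  split.
  - move=> t; rewrite in_itv /= => /andP[t0 t1].
    have t01 : 0 <= t <= 1 by rewrite !ltW.
    exact: (@ex_derive _ _ _ _ _ _ _ (dF t t01)).
  - by apply: cvg_at_right_filter; apply: cF; rewrite lexx ler01.
  - by apply: cvg_at_left_filter; apply: cF; rewrite lexx ler01.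
move=> t; rewrite in_itv /= => /andP[t0 t1].
have t01 : 0 <= t <= 1 by rewrite !ltW.
by rewrite derive1E (@derive_val _ _ _ _ _ _ _ (dF t t01)).
Qed.

(** Domination by the constant [M] permits differentiation under the integral at [s = 0]. The
    resulting integrand [k 0] has the primitive [H] in [t], so the fundamental theorem evaluates its
    integral. *)
Lemma is_derive_Rintegral (g k : R -> R -> R) (H : R -> R) (d M : R) : 0 < d ->
  (forall s : R, - d < s < d -> {within `[(0 : R), 1], continuous (g s)}) ->
  (forall s t : R, - d < s < d -> 0 <= t <= 1 ->
    is_derive s (1 : R) (g ^~ t) (k s t)) ->
  (forall s t : R, - d < s < d -> 0 <= t <= 1 -> `|k s t| <= M) ->
  {within `[(0 : R), 1], continuous (k 0)} ->
  (forall t : R, 0 <= t <= 1 -> is_derive t (1 : R) H (k 0 t)) ->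
  is_derive (0 : R) (1 : R) (fun s => \int[mu]_(t in `[0, 1]) g s t) (H 1 - H 0).
Proof.
move=> d0 cg dg bk ck dH.
have d0d : - d < 0 < d by rewrite oppr_lt0 d0.
have m01 : measurable (`[0, 1]%classic : set (measurableTypeR R)) by [].
have I0 : `]- d, d[%classic (0 : R) by rewrite /= in_itv /=.
have intg s : `]- d, d[%classic s -> mu.-integrable `[0, 1] (EFin \o g s).
  rewrite /= in_itv /= => sd; apply: continuous_compact_integrable; last exact: cg.
  exact: segment_compact.
have derg s t : `]- d, d[%classic s -> `[(0 : R), 1]%classic t ->
    derivable (g ^~ t) s 1.
  rewrite /= !in_itv /= => sd t01.
  exact: (@ex_derive _ _ _ _ _ _ _ (dg s t sd t01)).
have M0 : 0 <= M by apply: le_trans (bk 0 0 d0d _); rewrite ?lexx ?ler01.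
have intM : mu.-integrable `[0, 1] (EFin \o cst M).
  by apply: continuous_compact_integrable => [|t]; [exact: segment_compact|exact: cvg_cst].
have dk s t : - d < s < d -> 0 <= t <= 1 -> partial1of2 g s t = k s t.
  move=> sd t01; rewrite /partial1of2 derive1E.
  exact: (@derive_val _ _ _ _ _ _ _ (dg s t sd t01)).
have bg s t : `]- d, d[%classic s -> `[(0 : R), 1]%classic t ->
    `|partial1of2 g s t| <= M.
  by rewrite /= !in_itv /= => sd t01; rewrite dk //; exact: bk.
apply: DeriveDef.
  exact: (derivable_under_integral m01 I0 intg derg (fun=> M0) intM bg).
rewrite -derive1E (differentiation_under_integral m01 I0 intg derg (fun=> M0) intM bg).
rewrite -(Rintegral_derive dH ck); apply: eq_Rintegral => t.
by rewrite inE /= in_itv /= => t01; rewrite dk.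
Qed.

End Leibniz.

(** * The Poincare lemma on a ball *)

Section Poincare.
Variables (R : realType) (n : nat).
Local Notation mu := (@lebesgue_measure R).
Implicit Types (f : 'rV[R]_n -> R^o) (x u v w : 'rV[R]_n).

Lemma in_ball x0 (r : R) x : ball x0 r x <-> `|x - x0| < r.
Proof. by rewrite -ball_normE /ball_ /= distrC. Qed.

(** Supplies the constants that dominate the integrand of the ray integral. Compactness is available
    on a closed ball strictly inside the open ball where [f] is continuous. *)
Lemma bounded_on_closed_ball x0 (r r1 : R) f : 0 < r1 -> r1 < r ->
  (forall x, ball x0 r x -> {for x, continuous f}) ->
  exists M : R, forall x, `|x - x0| <= r1 -> `|f x| <= M.
Proof.
move=> r10 r1r cf; pose K := closed_ball x0 r1.
have KE x : K x = (`|x0 - x| <= r1) :> Prop by rewrite /K closed_ballE.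
have cK : compact K.
  apply: bounded_closed_compact; last exact: closed_ball_closed.
  exists (`|x0| + r1); split; first exact: num_real.
  move=> M ltM x; rewrite KE distrC => xr1; apply: le_trans (ltW ltM).
  by rewrite -(subrK x0 x) [leRHS]addrC; apply: le_trans (ler_normD _ _) _; rewrite lerD2r.
have cfK : {within K, continuous (fun x => `|f x|)}.
  apply: continuous_in_subspaceT => x; rewrite inE KE => xK.
  apply: continuous_comp; last exact: norm_continuous.
  by apply: cf; apply/in_ball; rewrite distrC; exact: le_lt_trans r1r.
have K0 : K !=set0 by exists x0; rewrite KE subrr normr0 ltW.
have [c _ cM] := EVT_max_rV K0 cK cfK.
exists `|f c| => x xr; apply: cM; rewrite inE KE distrC //.
Qed.

Lemma mx_entry_le_norm (x : 'rV[R]_n) a : `|x 0 a| <= `|x|.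
Proof. by rewrite {2}/Num.norm /= mx_normrE; exact: (le_bigmax _ _ (0, a)). Qed.

(** Derivatives in all directions are given, not only along the axes, so one use of the mean value
    theorem along the increment [h] replaces the usual path parallel to the axes. *)
Lemma differentiable_of_partials U f (beta : 'I_n -> 'rV[R]_n -> R^o) x :
  open U -> U x ->
  (forall u y, U y -> is_derive y u f (\sum_a u 0 a * beta a y)) ->
  (forall a, {for x, continuous (beta a)}) ->
  differentiable f x.
Proof.
move=> oU Ux df cb.
(* An auxiliary function whose differential provides the candidate derivative as a continuous linear
   map. *)
pose L : 'rV[R]_n -> R^o := \sum_a (fun y : 'rV[R]_n => beta a x * y 0 a).
have dL : differentiable L x.
  apply: differentiable_sum => a; apply: (differentiableM (differentiable_cst _ _)).
  exact: differentiable_coord.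
have L' h : 'd L x h = \sum_a h 0 a * beta a x.
  rewrite -deriveE // derive_sum; last first.
    move=> a; apply: diff_derivable; apply: (differentiableM (differentiable_cst _ _)).
    exact: differentiable_coord.
  apply: eq_bigr => a _; rewrite (@deriveMl _ _ (fun y : 'rV[R]_n => y 0 a)).
    rewrite -(@derive_entry _ _ _ _ (fun y => y)); last exact: derivable_id.
    by rewrite derive_id mulrC.
  by apply: diff_derivable; exact: differentiable_coord.
apply: (@differentiable_linear_approx _ _ _ _ ('d L x)).
  exact: diff_continuous.
move=> e e0.
(* One share of [e] for each coordinate; the successor keeps the share positive when [n = 0]. *)
have en : 0 < e / n.+1%:R by rewrite divr_gt0.
have nU : \forall y \near x, U y by exact: open_nbhs_nbhs.
have nb : \forall y \near x, forall a, `|beta a x - beta a y| < e / n.+1%:R.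
  apply: (@filter_forall _ _
    (fun a y => `|beta a x - beta a y| < e / n.+1%:R) (nbhs x) _) => a.
  exact: (@cvgr_dist_lt _ R _ _ _ (beta a) _ (cb a)).
have [r /= r0 rN] := (nbhs_ballP _ _).1 (filterI nU nb).
apply/nbhs_ballP; exists r => //= h.
rewrite -ball_normE /ball_ /= sub0r normrN => hr.
have xsh (s : R) : 0 <= s <= 1 -> ball x r (x + s *: h).
  move=> /andP[s0 s1]; apply/in_ball; rewrite addrC addKr normrZ ger0_norm //.
  by apply: le_lt_trans hr; rewrite ler_piMl.
have dfh (s : R) : 0 <= s <= 1 -> derivable f (x + s *: h) h.
  by move=> /xsh/rN[Us _]; exact: (@ex_derive _ _ _ _ _ _ _ (df h _ Us)).
have [s s01] := mean_value_line ler01 dfh.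
have [Us bs] := rN _ (xsh s s01).
rewrite scale1r mul1r (@derive_val _ _ _ _ _ _ _ (df h _ Us)) [h + x]addrC => ->.
rewrite L' -sumrB; apply: le_trans (ler_norm_sum _ _ _) _.
apply: (@le_trans _ _ (\sum_(a < n) (`|h| * (e / n.+1%:R)))).
  apply: ler_sum => a _; rewrite -mulrBr normrM; apply: ler_pM => //.
    exact: mx_entry_le_norm.
  by rewrite distrC; exact/ltW/bs.
rewrite sumr_const card_ord -[leLHS]mulr_natl mulrCA [leRHS]mulrC; apply: ler_wpM2l => //.
by rewrite mulrCA ger_pMr // ler_pdivrMr ?ltr0n // mul1r ler_nat.
Qed.

Lemma smooth_on_of_partials U f (beta : 'I_n -> 'rV[R]_n -> R^o) : open U ->
  (forall u y, U y -> is_derive y u f (\sum_a u 0 a * beta a y)) ->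
  (forall a, smooth_on U (beta a)) -> smooth_on U f.
Proof.
move=> oU df sb; have dif x : U x -> differentiable f x.
  move=> Ux; apply: (differentiable_of_partials oU Ux df) => a.
  by apply: differentiable_continuous; exact: smooth_on_differentiable Ux.
apply/smooth_onP; case=> [|k]; split=> // v.
have : smooth_on U (fun y => \sum_a v 0 a * beta a y : R^o).
  apply: smooth_on_sum => // a _.
  by apply: smooth_onM => //; exact: (@smooth_on_cst R n R^o).
move=> /(eq_smooth_on oU) sD; have /smooth_onP : smooth_on U ('D_v f); last exact.
by apply: sD => y Uy; rewrite (@derive_val _ _ _ _ _ _ _ (df v y Uy)).
Qed.


Lemma is_derive_of_line f x u (d : R) :
  is_derive (0 : R) (1 : R) (fun s : R => f (x + s *: u) : R) d -> is_derive x u f d.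
Proof.
move=> [df <-].
have E : (fun h : R => h^-1 *: (((fun s : R => f (x + s *: u) : R) \o shift 0) (h *: (1 : R))
      - f (x + (0 : R) *: u))) =
    (fun h => h^-1 *: ((f \o shift x) (h *: u) - f x)).
  apply/funext => h; congr (_ *: (f _ - f _)) => /=.
    by rewrite [h%:A]mulr1 addr0 addrC.
  by rewrite scale0r addr0.
by move: df; rewrite /derivable /derive E => df; apply: DeriveDef.
Qed.

Lemma is_derive_sum_fun (F : 'I_n -> R -> R) (dF : 'I_n -> R) (t : R) :
  (forall a, is_derive t (1 : R) (F a) (dF a)) ->
  is_derive t (1 : R) (fun t => \sum_a F a t) (\sum_a dF a).
Proof.
move=> dFt; have -> : (fun t => \sum_a F a t) = \sum_a F a.
  by apply/funext => s; rewrite fct_sumE.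
exact: is_derive_sum.
Qed.

Section RayIntegral.
Variables (x0 : 'rV[R]_n) (r : R) (beta : 'I_n -> 'rV[R]_n -> R^o).
Hypothesis sbeta : forall a, smooth_on (ball x0 r) (beta a).
Hypothesis closed_beta : forall a b x, ball x0 r x ->
  'D_(delta_mx 0 b) (beta a) x = 'D_(delta_mx 0 a) (beta b) x.

Let dbeta a x : ball x0 r x -> differentiable (beta a) x.
Proof. exact: smooth_on_differentiable. Qed.

Let dDbeta a u x : ball x0 r x -> differentiable ('D_u (beta a)) x.
Proof. by apply: smooth_on_differentiable; exact: smooth_on_derive. Qed.

(** The homotopy operator of the Poincare lemma: the 1-form with components [beta], integrated along
    the segment from [x0] to [x]. *)
Definition ray_integral : 'rV[R]_n -> R^o := fun x =>
  \int[mu]_(t in `[0, 1]) \sum_a (x - x0) 0 a * beta a (x0 + t *: (x - x0)).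

(** In this bilinear form, closedness trades a derivative in the direction [u] for one along the ray
    direction [w]. *)
Lemma closed_form_sym u w y : ball x0 r y ->
  \sum_a w 0 a * 'D_u (beta a) y = \sum_a u 0 a * 'D_w (beta a) y.
Proof.
move=> By; under eq_bigr do rewrite (derive_sum_coord _ (dbeta _ By)) mulr_sumr.
under [RHS]eq_bigr do rewrite (derive_sum_coord _ (dbeta _ By)) mulr_sumr.
rewrite exchange_big /=; apply: eq_bigr => b _; apply: eq_bigr => a _.
by rewrite closed_beta // [LHS]mulrCA.
Qed.

(** Write beta(u) for the value of the 1-form on [u]. By closedness, the [u]-derivative of the
    integrand is the [t]-derivative of t beta(u) taken at x0 + t w; integration from 0 to 1 leaves
    beta(u) at [x]. *)
Lemma is_derive_ray_integral u x : ball x0 r x ->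
  is_derive x u ray_integral (\sum_a u 0 a * beta a x).
Proof.
move=> Bx; pose w := x - x0.
have wr : `|w| < r by apply/in_ball.
(* A radius strictly between |w| and [r]: uniform bounds exist on the closed ball of radius [r1]. *)
pose r1 := (`|w| + r) / 2.
have wr1 : `|w| < r1 by rewrite /r1 midf_lt.
have r1r : r1 < r by rewrite /r1 midf_lt.
have r10 : 0 < r1 by exact: le_lt_trans wr1.
(* Chosen so that |w| + |s| |u| <= r1 whenever |s| < d; the added 1 covers u = 0. *)
pose d := (r1 - `|w|) / (`|u| + 1).
have u1 : 0 < `|u| + 1 by rewrite ltr_wpDl.
have d0 : 0 < d by rewrite divr_gt0 // subr_gt0.
have bws s : - d < s < d -> `|w + s *: u| <= r1.
  rewrite -ltr_norml => sd; apply: le_trans (ler_normD _ _) _.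
  rewrite -lerBrDl normrZ; apply: (@le_trans _ _ (d * (`|u| + 1))).
    by apply: ler_pM => //; [exact: ltW|rewrite lerDl].
  by rewrite /d divfK // gt_eqF.
pose z (s t : R) := x0 + t *: (w + s *: u).
have zr1 s t : - d < s < d -> 0 <= t <= 1 -> `|z s t - x0| <= r1.
  move=> sd /andP[t0 t1]; rewrite /z addrC addKr normrZ ger0_norm //.
  by apply: le_trans (bws s sd); rewrite ler_piMl.
have zB s t : - d < s < d -> 0 <= t <= 1 -> ball x0 r (z s t).
  by move=> sd t01; apply/in_ball; apply: le_lt_trans r1r; exact: zr1.
have sd0 : - d < 0 < d by rewrite oppr_lt0 d0.
(* [g] is the integrand for the endpoint x + s u, [k] its derivative in [s], and [H] a primitive of
   [k 0]. *)
pose g (s t : R) : R := \sum_a (w 0 a + s * u 0 a) * beta a (z s t).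
pose k (s t : R) : R := \sum_a ((w 0 a + s * u 0 a) * (t * 'D_u (beta a) (z s t)) +
  beta a (z s t) * u 0 a).
pose H (t : R) : R := t * \sum_a u 0 a * beta a (z 0 t).
have zline s t : z s t = (x0 + t *: w) + s *: (t *: u).
  by rewrite /z scalerDr addrA [t *: (s *: u)]scalerA mulrC -scalerA.
have zline0 t : z 0 t = x0 + t *: w by rewrite /z scale0r addr0.
have z1 s t a : - d < s < d -> 0 <= t <= 1 ->
    is_derive s (1 : R) (fun s => beta a (z s t) : R) (t * 'D_u (beta a) (z s t)).
  move=> sd t01; have Bz := zB s t sd t01.
  have := @is_derive_line R n (beta a) (x0 + t *: w) (t *: u) s.
  rewrite -zline => /(_ (diff_derivable (dbeta a Bz))).
  rewrite deriveE ?linearZ; last exact: dbeta.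
  rewrite -deriveE; last exact: dbeta.
  congr (is_derive _ _ _ _); apply/funext => s'; by rewrite zline.
have z2 (f : 'rV[R]_n -> R^o) t : 0 <= t <= 1 -> differentiable f (z 0 t) ->
    is_derive t (1 : R) (fun t => f (z 0 t) : R) ('D_w f (z 0 t)).
  move=> t01 df; have := @is_derive_line R n f x0 w t.
  rewrite -zline0 => /(_ (diff_derivable df)).
  congr (is_derive _ _ _ _); apply/funext => s'; by rewrite zline0.
apply: is_derive_of_line.
have dprod (A B : R -> R) (a b c t : R) : is_derive t (1 : R) A a ->
    is_derive t (1 : R) B b -> c = A t * b + B t * a ->
    is_derive t (1 : R) (fun t => A t * B t) c.
  by move=> dA dB ->; exact: (@is_deriveM _ _ A B t 1 a b).
have dcst (c t : R) : is_derive t (1 : R) (fun=> c) 0 by exact: is_derive_cst.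
have did (t : R) : is_derive t (1 : R) (fun t => t) 1 by exact: is_derive_id.
have dadd (A B : R -> R) (a b t : R) : is_derive t (1 : R) A a ->
    is_derive t (1 : R) B b -> is_derive t (1 : R) (fun t => A t + B t) (a + b).
  by move=> dA dB; exact: (@is_deriveD _ _ _ A B t 1 a b).
have daff (b c t : R) : is_derive t (1 : R) (fun t => b + t * c) c.
  have E : 0 + (t * 0 + c * 1) = c by rewrite mulr0 mulr1 !add0r.
  rewrite -[X in is_derive _ _ _ X]E.
  exact: (dadd (fun=> b) (fun t => t * c) _ _ _ (dcst b t)
    (dprod (fun t => t) (fun=> c) _ _ _ _ (did t) (dcst c t) erefl)).
have -> : (fun s : R => ray_integral (x + s *: u) : R) =
    (fun s => \int[mu]_(t in `[0, 1]) g s t).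
  apply/funext => s; apply: eq_Rintegral => t _; apply: eq_bigr => a _.
  by rewrite [x + _ - _]addrAC -/w /z !mxE.
have -> : \sum_a u 0 a * beta a x = H 1 - H 0.
  by rewrite /H mul0r subr0 mul1r zline0 scale1r [x0 + _]addrC subrK.
have inc (s t : R) : t \in `[(0 : R), 1] -> 0 <= t <= 1 by rewrite in_itv.
have /choice [B BP] : forall a, exists M : R, forall y, `|y - x0| <= r1 -> `|beta a y| <= M.
  move=> a; apply: (@bounded_on_closed_ball x0 r r1 (beta a) r10 r1r) => y By.
  by apply: differentiable_continuous; exact: dbeta.
have /choice [N NP] : forall a, exists M : R, forall y, `|y - x0| <= r1 ->
    `|'D_u (beta a) y| <= M.
  move=> a; apply: (@bounded_on_closed_ball x0 r r1 ('D_u (beta a)) r10 r1r) => y By.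
  by apply: differentiable_continuous; exact: dDbeta.
apply: (@is_derive_Rintegral R g k H d (\sum_a (r1 * N a + B a * `|u|)) d0).
- move=> s sd; apply: (@derivable_within_continuous R R (g s) `[0, 1]) => t /(inc s) t01.
  have Bz := zB s t sd t01.
  have d1 a := @is_derive_line R n (beta a) x0 (w + s *: u) t
    (diff_derivable (dbeta a Bz)).
  have d2 a := dprod (fun=> w 0 a + s * u 0 a) _ _ _ _ _ (dcst _ t) (d1 a) erefl.
  exact: (@ex_derive _ _ _ _ _ _ _ (is_derive_sum_fun d2)).
- move=> s t sd t01.
  have d1 a := dprod (fun s => w 0 a + s * u 0 a) (fun s => beta a (z s t)) _ _ _ _
    (daff _ _ s) (z1 s t a sd t01) erefl.
  exact: is_derive_sum_fun d1.
- move=> s t sd t01; apply: le_trans (ler_norm_sum _ _ _) _.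
  apply: ler_sum => a _; apply: le_trans (ler_normD _ _) _.
  apply: lerD; rewrite normrM; apply: ler_pM => //.
  + apply: le_trans (bws s sd).
    by have := mx_entry_le_norm (w + s *: u) a; rewrite !mxE.
  + case/andP: (t01) => t0 t1; rewrite normrM ger0_norm //.
    apply: (@le_trans _ _ `|'D_u (beta a) (z s t)|); first by rewrite ler_piMl.
    by apply: NP; exact: zr1.
  + by apply: BP; exact: zr1.
  + exact: mx_entry_le_norm.
- apply: (@derivable_within_continuous R R (k 0) `[0, 1]) => t /(inc 0) t01.
  have Bz := zB 0 t sd0 t01.
  have d1 a := dprod (fun t => t) (fun t => 'D_u (beta a) (z 0 t)) _ _ _ _
    (did t) (z2 _ t t01 (dDbeta a u Bz)) erefl.
  have d2 a := dprod (fun=> w 0 a + 0 * u 0 a) _ _ _ _ _ (dcst _ t) (d1 a) erefl.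
  have d3 a := dprod (fun t => beta a (z 0 t)) (fun=> u 0 a) _ _ _ _
    (z2 _ t t01 (dbeta a Bz)) (dcst _ t) erefl.
  exact: (@ex_derive _ _ _ _ _ _ _
    (is_derive_sum_fun (fun a => dadd _ _ _ _ _ (d2 a) (d3 a)))).
- move=> t t01; have Bz := zB 0 t sd0 t01.
  have d1 a := dprod (fun=> u 0 a) (fun t => beta a (z 0 t)) _ _ _ _
    (dcst _ t) (z2 _ t t01 (dbeta a Bz)) erefl.
  apply: (dprod (fun t => t) _ _ _ _ _ (did t) (is_derive_sum_fun d1)).
  under [in RHS]eq_bigr do rewrite mulr0 addr0.
  (* Closedness converts the derivative along [w] coming from [H] into the derivative along [u] that
     occurs in [k 0]. *)
  rewrite mulr1 -closed_form_sym // mulr_sumr -big_split /=; apply: eq_bigr => a _.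
  by rewrite mul0r addr0 mulrCA [u 0 a * _]mulrC.
Qed.

End RayIntegral.

Lemma poincare_ball x0 (r : R) (beta : 'I_n -> 'rV[R]_n -> R^o) :
  (forall a, smooth_on (ball x0 r) (beta a)) ->
  (forall a b x, ball x0 r x ->
    'D_(delta_mx 0 b) (beta a) x = 'D_(delta_mx 0 a) (beta b) x) ->
  exists f : 'rV[R]_n -> R^o, smooth_on (ball x0 r) f /\
    forall u x, ball x0 r x -> 'D_u f x = \sum_a u 0 a * beta a x.
Proof.
move=> sb cb; exists (ray_integral x0 beta).
have D := is_derive_ray_integral sb cb.
have oB : open (ball x0 r) by exact: ball_open.
split; first by apply: (smooth_on_of_partials oB _ sb) => u y By; exact: D.
by move=> u x Bx; exact: (@derive_val _ _ _ _ _ _ _ (D u x Bx)).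
Qed.

End Poincare.

Lemma csmooth_on_schwarz (R : realType) n (V : set 'rV[R]_n) (f : 'rV[R]_n -> R[i]) u v x :
  open V -> csmooth_on V f -> V x ->
  cderive u (cderive v f) x = cderive v (cderive u f) x.
Proof.
move=> oV [sr si] Vx.
exact: (f_equal2 (@Complex R) (smooth_on_schwarz u v oV sr Vx)
  (smooth_on_schwarz u v oV si Vx)).
Qed.


Lemma mx_smooth_on_schwarz (R : realType) n p q (V : set 'rV[R]_n)
    (F : 'rV[R]_n -> 'M[R[i]]_(p, q)) u v x : open V -> mx_smooth_on V F -> V x ->
  mx_derive u (mx_derive v F) x = mx_derive v (mx_derive u F) x.
Proof.
move=> oV sF Vx; apply/matrixP => a b.
have E s t : mx_derive s (mx_derive t F) x a b = cderive s (cderive t (fun y => F y a b)) x.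
  rewrite mxE; congr (cderive s _ x); apply/funext => y; exact: mxE.
exact: (etrans (E u v) (etrans (csmooth_on_schwarz u v oV (sF a b) Vx) (esym (E v u)))).
Qed.

(** * Forms of type (1,0) on a complex vector space *)

Section ComplexLinearAlgebra.
Variables (R : realType) (n m : nat).
Local Notation C := R[i].
Variable J : 'M[R]_n.
Hypothesis J2 : J *m J = - 1%:M.
Local Notation cJ := (complexify J).

(** The projection onto the i-eigenspace of [cJ]; in the row convention its columns are functionals
    of type (1,0). *)
Definition type10_proj : 'M[C]_n := 2^-1 *: (1%:M - 'i%C *: cJ).
Local Notation P := type10_proj.
Let Pbar : 'M[C]_n := 2^-1 *: (1%:M + 'i%C *: cJ).

Lemma complexify_sqr : cJ *m cJ = - 1%:M.
Proof. by rewrite -complexifyM J2 /complexify map_mxN map_scalar_mx rmorph1. Qed.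

Lemma sqr_imaginary : 'i%C * 'i%C = -1 :> C.
Proof. by rewrite -expr2 sqr_i. Qed.

Lemma half_neq0 : (2 : C) != 0. Proof. by rewrite pnatr_eq0. Qed.

Lemma mulmx_type10_proj : cJ *m P = 'i%C *: P.
Proof.
rewrite -scalemxAr [RHS]scalerA ['i%C * _]mulrC -scalerA; congr (_ *: _).
rewrite mulmxBr mulmx1 -scalemxAr complexify_sqr scalerN opprK.
by rewrite scalerBr scalerA sqr_imaginary scaleN1r opprK addrC.
Qed.

Lemma type10_proj_id q (N : 'M[C]_(n, q)) : cJ *m N = 'i%C *: N -> P *m N = N.
Proof.
move=> JN; rewrite -scalemxAl mulmxBl mul1mx -scalemxAl JN scalerA sqr_imaginary.
rewrite scaleN1r opprK -mulr2n -[N *+ 2]scaler_nat scalerA mulVf ?scale1r //; exact: half_neq0.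
Qed.

(** [P] and its conjugate have equal rank, sum to the identity and have product zero, so each has
    rank n / 2. *)
Lemma type10_proj_rank : n = (2 * m)%N -> \rank P = m.
Proof.
move=> n2m.
have PPbar : P + Pbar = 1%:M.
  rewrite -scalerDr addrACA addNr addr0 -mulr2n -[_%:M *+ 2]scaler_nat scalerA.
  rewrite mulVf ?scale1r //.
  exact: half_neq0.
have mPPbar : P *m Pbar = 0.
  rewrite -scalemxAl -scalemxAr.
  have AA : ('i%C *: cJ) *m ('i%C *: cJ) = 1%:M.
    by rewrite -scalemxAl -scalemxAr complexify_sqr scalerA sqr_imaginary scaleN1r opprK.
  by rewrite mulmxDr mulmx1 mulmxBl mul1mx AA -[X in _ + X]opprB subrr !scaler0.
have rPbar : \rank Pbar = \rank P.
  have -> : Pbar = map_mx conjc P.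
    apply/matrixP => a b; rewrite !mxE; apply/eqP.
    by case: (a == b); rewrite eq_complex /=; apply/andP; split; apply/eqP; ring.
  exact: mxrank_map.
have := mulmx0_rank_max mPPbar; have := mxrank_add P Pbar.
rewrite PPbar mxrank1 rPbar; move: (\rank P) => r; lia.
Qed.

(** A rank count shows that the columns of [theta] span those of [P]. Hence P = theta D for some D,
    and A0 theta = 1 identifies D with A0 P. *)
Lemma type10_proj_factor (A0 : 'M[C]_(m, n)) (theta : 'M[C]_(n, m)) :
  n = (2 * m)%N -> A0 *m theta = 1%:M -> cJ *m theta = 'i%C *: theta ->
  theta *m (A0 *m P) = P.
Proof.
move=> n2m At Jt.
have Pt : P *m theta = theta by exact: type10_proj_id.
have sub : (theta^T <= P^T)%MS by apply/submxP; exists theta^T; rewrite -trmx_mul Pt.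
have rt : \rank theta^T = m.
  have /eqP : row_free theta^T.
    by apply/row_freeP; exists A0^T; rewrite -trmx_mul At trmx1.
  by [].
have sup : (P^T <= theta^T)%MS.
  have [_ <-] := mxrank_leqif_sup sub.
  by rewrite rt mxrank_tr type10_proj_rank.
have /submxP [D PD] := sup.
have PE : P = theta *m D^T by rewrite -[P]trmxK PD trmx_mul trmxK.
by rewrite PE !mulmxA -[theta *m A0 *m theta]mulmxA At mulmx1.
Qed.

(** [A0] reads off the coordinates, in the frame [theta], of anything in the i-eigenspace. *)
Lemma eigenspace_factor (A0 : 'M[C]_(m, n)) (theta : 'M[C]_(n, m)) q (N : 'M[C]_(n, q)) :
  n = (2 * m)%N -> A0 *m theta = 1%:M -> cJ *m theta = 'i%C *: theta ->
  cJ *m N = 'i%C *: N -> theta *m (A0 *m N) = N.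
Proof.
move=> n2m At Jt JN; rewrite -{1}(type10_proj_id JN).
by rewrite [A0 *m _]mulmxA mulmxA type10_proj_factor // type10_proj_id.
Qed.

(** Since [K] commutes with [cJ], it preserves the i-eigenspace, and the trace in the conclusion is
    that of its restriction: tr(P K) = (tr K - i tr(cJ K)) / 2. *)
Lemma trace_type10 (A0 : 'M[C]_(m, n)) (theta : 'M[C]_(n, m)) (K : 'M[C]_n) :
  n = (2 * m)%N -> A0 *m theta = 1%:M -> cJ *m theta = 'i%C *: theta ->
  K *m cJ = cJ *m K -> \tr K = 0 -> \tr (cJ *m K) = 0 -> \tr (A0 *m K *m theta) = 0.
Proof.
move=> n2m At Jt KJ tK tJK.
have KP : K *m P = P *m K.
  by rewrite -scalemxAl -scalemxAr mulmxBl mulmxBr mulmx1 mul1mx -scalemxAl -scalemxAr KJ.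
rewrite -(type10_proj_id Jt) -mulmxA mxtrace_mulC -!mulmxA.
rewrite [K *m (P *m _)]mulmxA KP -!mulmxA.
rewrite mxtrace_mulC -!mulmxA type10_proj_factor // KP.
rewrite -scalemxAl mulmxBl mul1mx -scalemxAl -scaleNr mxtraceZ mxtraceD mxtraceZ.
by rewrite tK tJK mulr0 addr0 mulr0.
Qed.

(** [A0] selects [m] independent rows of [P]. Made of rows of the identity, it is real, so that its
    rows are tangent vectors on which the volume form can be evaluated. *)
Lemma exists_frame : n = (2 * m)%N ->
  exists (A0 : 'M[R]_(m, n)) (T : 'M[C]_(n, m)), complexify A0 *m P *m T = 1%:M.
Proof.
move=> n2m; have rP := type10_proj_rank n2m.
have := maxrowsub_free P; move: (maxrankfun P); rewrite rP => f /row_freeP [T fT].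
exists (rowsub f 1%:M), T; rewrite -[RHS]fT; congr (_ *m _).
apply/matrixP => a b; rewrite !mxE (bigD1 (f a)) //= !mxE eqxx mul1r big1 ?addr0 //.
by move=> c cf; rewrite !mxE eq_sym (negbTE cf) mul0r.
Qed.

End ComplexLinearAlgebra.

(** * Curvature *)

Lemma derive_mulmxl (R : realType) n p q r (w : 'M[R]_(p, q))
    (F : 'rV[R]_n -> 'M[R]_(q, r)) u x :
  derivable F x u -> 'D_u (fun y => w *m F y) x = w *m 'D_u F x.
Proof.
move=> dF; have dFij i j : derivable (fun y => F y i j : R^o) x u by move/derivable_mxP : dF.
have dk i j k : derivable (fun y => w i k * F y k j : R^o) x u.
  by apply: (@derivableM _ _ (cst (w i k)) (fun y => F y k j : R^o)).
have E i j : (fun y => (w *m F y) i j : R^o) = \sum_k (fun y => w i k * F y k j : R^o).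
  by apply/funext => y; rewrite mxE fct_sumE.
rewrite derive_mx; last first.
  by apply/derivable_mxP => i j; rewrite E; exact: derivable_sum.
apply/matrixP => i j; rewrite !mxE E derive_sum //.
apply: eq_bigr => k _; rewrite derive_entry //.
by rewrite (@deriveMl _ _ (fun y => F y k j : R^o)).
Qed.

Section Curvature.
Variables (R : realType) (n : nat) (M : manifold R n) (nabla : connection M).
Variable i : chart M.
Implicit Types (u v w x y : 'rV[R]_n).
Local Notation U := (image_in i setT).

Lemma image_inT_open : open U.
Proof. by rewrite /image_in setIT; exact: coords_open. Qed.

Definition connection_form u y : 'M[R]_n := \sum_a u 0 a *: christoffel nabla i y a.
Local Notation Gam := connection_form.

Lemma christoffel_mapE x u v :
  christoffel_map (christoffel nabla i) x u v = v *m Gam u x.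
Proof. by rewrite mulmx_sumr; apply: eq_bigr => a _; rewrite scalemxAr. Qed.

Lemma christoffel_differentiable a x : U x ->
  differentiable (fun y => christoffel nabla i y a) x.
Proof.
move=> Ux.
exact: (smooth_on_differentiable (@christoffel_smooth _ _ _ nabla i a) Ux).
Qed.

Lemma connection_form_differentiable u x : U x -> differentiable (Gam u) x.
Proof.
move=> Ux; have -> : Gam u = \sum_a (u 0 a *: (fun y => christoffel nabla i y a)).
  by apply/funext => y; rewrite fct_sumE.
apply: differentiable_sum => a; apply: differentiableZ.
exact: christoffel_differentiable.
Qed.

Lemma connection_form_smooth u a b : smooth_on U (fun y => Gam u y a b : R^o).
Proof.
have oU := image_inT_open.
have -> : (fun y => Gam u y a b : R^o) =
    (fun y => \sum_c u 0 c * christoffel nabla i y c a b).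
  by apply/funext => y; rewrite summxE; apply: eq_bigr => c _; rewrite mxE.
apply: smooth_on_sum => // c _; apply: smooth_onM => //.
  exact: (@smooth_on_cst R n R^o).
exact: smooth_on_entry oU (@christoffel_smooth _ _ _ nabla i c).
Qed.

Lemma connection_form_sum u y : Gam u y = \sum_a u 0 a *: Gam (delta_mx 0 a) y.
Proof.
apply: eq_bigr => a _; congr (_ *: _); rewrite /Gam (bigD1 a) //= mxE !eqxx scale1r.
by rewrite big1 ?addr0 // => b ba; rewrite mxE eqxx (negbTE ba) scale0r.
Qed.

(** Matrices act on rows from the right, so products occur in the order opposite to that of the
    operators: nabla_u nabla_v contributes [Gam v x *m Gam u x]. *)
Definition curvature_form u v x : 'M[R]_n :=
  'D_u (Gam v) x - 'D_v (Gam u) x + Gam v x *m Gam u x - Gam u x *m Gam v x.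
Local Notation K := curvature_form.

Lemma covariant_cst v w : covariant nabla i (cst v) (cst w) = fun y => w *m Gam v y.
Proof. by apply/funext => y; rewrite /covariant derive_cst add0r christoffel_mapE. Qed.

Lemma lie_bracket_cst u v x : lie_bracket (cst u) (cst v) x = 0.
Proof. by rewrite /lie_bracket !derive_cst subrr. Qed.

Lemma covariant0 X Z x : X x = 0 -> covariant nabla i X Z x = 0.
Proof.
move=> X0; rewrite /covariant X0 derive0 add0r /christoffel_map big1 // => a _.
by rewrite mxE scale0r.
Qed.

Lemma curvature_cst u v w x : U x ->
  curvature nabla i (cst u) (cst v) (cst w) x = w *m K u v x.
Proof.
move=> Ux; rewrite /curvature !covariant_cst [X in _ - X]covariant0 ?lie_bracket_cst // subr0.
have dG t s : derivable (Gam t) x s.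
  by apply: diff_derivable; exact: connection_form_differentiable.
rewrite /covariant !christoffel_mapE (derive_mulmxl w (dG v u)) (derive_mulmxl w (dG u v)).
rewrite /K !mulmxDr !mulmxN !mulmxA.
move: (w *m _) (w *m _) (w *m _ *m _) (w *m _ *m _) => a b c d.
by apply/rowP => j; rewrite !mxE; ring.
Qed.

Lemma curvature_form_antisym u v x : K u v x = - K v u x.
Proof. by rewrite /K !opprD !opprK [in RHS]addrAC [X in _ = X + _ + _]addrC. Qed.

Lemma derive_connection_form_sum u v x : U x ->
  'D_u (Gam v) x = \sum_a v 0 a *: 'D_u (Gam (delta_mx 0 a)) x.
Proof.
move=> Ux; have -> : Gam v = \sum_a (v 0 a *: Gam (delta_mx 0 a)).
  by apply/funext => y; rewrite fct_sumE connection_form_sum.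
have dG a : derivable (Gam (delta_mx 0 a)) x u.
  by apply: diff_derivable; exact: connection_form_differentiable.
rewrite derive_sum => [|a]; last exact: derivableZ.
by apply: eq_bigr => a _; rewrite deriveZ.
Qed.

Lemma curvature_form_sum u v x : U x ->
  K u v x = \sum_a v 0 a *: K u (delta_mx 0 a) x.
Proof.
move=> Ux; rewrite /K (derive_connection_form_sum _ _ Ux).
rewrite (derive_sum_coord _ (connection_form_differentiable _ Ux)).
rewrite (connection_form_sum v x) mulmx_suml mulmx_sumr -!sumrB -big_split -sumrB /=.
apply: eq_bigr => a _; rewrite -scalemxAl -scalemxAr.
by rewrite -scalerBr -scalerDr -scalerBr.
Qed.

Lemma image_in_smooth_cst v : smooth_on U (cst v : vfield R n).
Proof. exact: smooth_on_cst. Qed.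

Hypothesis tf : torsion_free nabla.

Lemma torsion_free_sym u v x : U x -> v *m Gam u x = u *m Gam v x.
Proof.
move=> Ux; have := tf (image_in_smooth_cst u) (image_in_smooth_cst v) Ux.
rewrite /torsion lie_bracket_cst subr0 !covariant_cst => /eqP.
by rewrite subr_eq0 => /eqP.
Qed.

Lemma derive_torsion_free_sym u v w x : U x ->
  v *m 'D_w (Gam u) x = u *m 'D_w (Gam v) x.
Proof.
move=> Ux; have dG t : derivable (Gam t) x w.
  by apply: diff_derivable; exact: connection_form_differentiable.
rewrite -(derive_mulmxl v (dG u)) -(derive_mulmxl u (dG v)).
apply: (open_eq_derive _ image_inT_open _ Ux) => y Uy.
exact: torsion_free_sym.
Qed.

(** On constant fields torsion-freeness says that [v *m Gam u x] is symmetric in [u] and [v], and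
    this passes to derivatives; all terms then cancel in pairs. *)
Lemma bianchi u v w x : U x ->
  w *m K u v x + u *m K v w x + v *m K w u x = 0.
Proof.
move=> Ux; rewrite /K !mulmxDr !mulmxN !mulmxA.
have -> : w *m Gam v x = v *m Gam w x by exact: torsion_free_sym.
have -> : w *m Gam u x = u *m Gam w x by exact: torsion_free_sym.
have -> : v *m Gam u x = u *m Gam v x by exact: torsion_free_sym.
have -> : w *m 'D_u (Gam v) x = v *m 'D_u (Gam w) x by exact: derive_torsion_free_sym.
have -> : u *m 'D_v (Gam w) x = w *m 'D_v (Gam u) x by exact: derive_torsion_free_sym.
have -> : v *m 'D_w (Gam u) x = u *m 'D_w (Gam v) x by exact: derive_torsion_free_sym.
move: (v *m 'D_u _ x) (w *m 'D_v _ x) (u *m 'D_w _ x) => a b c.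
move: (v *m Gam w x *m _) (u *m Gam w x *m _) (u *m Gam v x *m _) => d e f.
by apply/rowP => j; rewrite !mxE; ring.
Qed.

Hypothesis rf : ricci_flat nabla.

Lemma ricci_flat_sum u w x : U x ->
  \sum_a (w *m K u (delta_mx 0 a) x) 0 a = 0.
Proof.
move=> Ux; have := rf (image_in_smooth_cst u) (image_in_smooth_cst w) Ux.
by rewrite /ricci /mxtrace; under eq_bigr do rewrite mxE curvature_cst //.
Qed.

(* The first Bianchi identity turns the trace of J K(u, v) into two Ricci terms. *)
Lemma ricci_flat_trace (J : 'M[R]_n) x : U x ->
  (forall u v, K u v x *m J = J *m K u v x) ->
  forall u v, \tr (J *m K u v x) = 0.
Proof.
move=> Ux JK u v.
(* Commutation moves J out of the direction argument of [K], which turns the contraction into the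
   Ricci term of [t] and [s *m J]. *)
have H (s t : 'rV[R]_n) : \sum_a (s *m K t (row a J) x) 0 a = 0.
  transitivity (\sum_b (s *m J *m K t (delta_mx 0 b) x) 0 b); last first.
    exact: (ricci_flat_sum t (s *m J) Ux).
  transitivity (\sum_a \sum_b J a b * (s *m K t (delta_mx 0 b) x) 0 a).
    apply: eq_bigr => a _; rewrite curvature_form_sum // mulmx_sumr summxE.
    by apply: eq_bigr => b _; rewrite -scalemxAr !mxE.
  rewrite exchange_big; apply: eq_bigr => b _ /=.
  rewrite -mulmxA -JK mulmxA [RHS]mxE; apply: eq_bigr => a _.
  by rewrite mulrC.
(* The Bianchi identity contracted over the rows of J: the first term gives tr(J K), and [H] removes
   the other two. *)
have : \sum_a (row a J *m K u v x + u *m K v (row a J) x + v *m K (row a J) u x) 0 a = 0.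
  by apply: big1 => a _; rewrite bianchi // mxE.
under eq_bigr do
  rewrite [K (row _ _) u x]curvature_form_antisym mulmxN mxE mxE [X in _ + X]mxE.
rewrite !big_split /= H sumrN H subr0 addr0 => E; rewrite -[RHS]E /mxtrace.
by apply: eq_bigr => a _; rewrite -row_mul [RHS]mxE.
Qed.

End Curvature.

(** * Parallel complex structures commute with the curvature *)

Section ParallelEndo.
Variables (R : realType) (n : nat) (M : manifold R n) (nabla : connection M).
Variables (J : chart M -> 'rV[R]_n -> 'M[R]_n) (i : chart M).
Implicit Types (u v w x y : 'rV[R]_n).
Local Notation U := (image_in i setT).
Local Notation Gam := (connection_form nabla i).
Local Notation K := (curvature_form nabla i).
Hypothesis cJ : complex_structure J.
Hypothesis pJ : parallel_endo nabla J.

Lemma mulmx_rV_inj (p : nat) (A B : 'M[R]_(n, p)) :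
  (forall w : 'rV[R]_n, w *m A = w *m B) -> A = B.
Proof. by move=> AB; apply/row_matrixP => a; rewrite !rowE AB. Qed.

Lemma parallel_endo_derive u x : U x ->
  'D_u (J i) x = Gam u x *m J i x - J i x *m Gam u x.
Proof.
move=> Ux; have [sJ _ _] := cJ; apply: mulmx_rV_inj => w.
have := pJ (image_in_smooth_cst u) (image_in_smooth_cst w) Ux.
rewrite /covariant derive_cst add0r !christoffel_mapE derive_mulmxl; last first.
  by apply: diff_derivable; exact: smooth_on_differentiable (sJ i) Ux.
by rewrite mulmxBr !mulmxA => <-; rewrite addrK.
Qed.

Lemma complex_structure_entry_smooth a b : smooth_on U (fun y => J i y a b : R^o).
Proof.
have [sJ _ _] := cJ; apply: smooth_on_entry (sJ i); exact: image_inT_open.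
Qed.

Lemma mx_smooth_complex_structure : mx_smooth_on U (fun y => complexify (J i y)).
Proof. by apply: mx_smooth_on_real => a b; exact: complex_structure_entry_smooth. Qed.

Lemma mx_smooth_connection_form u : mx_smooth_on U (fun y => complexify (Gam u y)).
Proof. by apply: mx_smooth_on_real => a b; exact: connection_form_smooth. Qed.

Lemma mx_derive_connection_form u v x : U x ->
  mx_derive v (fun y => complexify (Gam u y)) x = complexify ('D_v (Gam u) x).
Proof.
move=> Ux; apply: mx_derive_real => a b.
by apply: smooth_on_differentiable Ux; exact: connection_form_smooth.
Qed.

Lemma mx_derive_complex_structure u x : U x ->
  mx_derive u (fun y => complexify (J i y)) x =
  complexify (Gam u x) *m complexify (J i x) - complexify (J i x) *m complexify (Gam u x).
Proof.
move=> Ux; rewrite mx_derive_real; last first.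
  by move=> a b; apply: smooth_on_differentiable Ux; exact: complex_structure_entry_smooth.
by rewrite parallel_endo_derive // -!complexifyM [LHS]map_mxB.
Qed.

(** The integrability condition of nabla J = 0: its derivatives express the second derivatives of J,
    which have to be symmetric. Complexification makes the product rule [mx_deriveM] available. *)
Lemma curvature_form_comm u v x : U x -> K u v x *m J i x = J i x *m K u v x.
Proof.
move=> Ux; have oU : open U by exact: image_inT_open.
pose cG u y := complexify (Gam u y); pose cJ' y := complexify (J i y).
have sJ := mx_smooth_complex_structure.
have dJ := mx_smooth_on_differentiable sJ Ux.
have dG s := mx_smooth_on_differentiable (mx_smooth_connection_form s) Ux.
(* First derivatives of J are replaced by commutators with the connection form. *)
have D s t : mx_derive s (mx_derive t cJ') x =
    mx_derive s (cG t) x *m cJ' x + cG t x *m (cG s x *m cJ' x - cJ' x *m cG s x)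
    - ((cG s x *m cJ' x - cJ' x *m cG s x) *m cG t x + cJ' x *m mx_derive s (cG t) x).
  rewrite (open_eq_mx_derive _ oU (mx_derive_complex_structure t) Ux).
  have [d1 d2] := (mx_differentiableM (dG t) dJ, mx_differentiableM dJ (dG t)).
  rewrite (mx_deriveB s d1 d2) (mx_deriveM s (dG t) dJ) (mx_deriveM s dJ (dG t)).
  by rewrite (mx_derive_complex_structure s Ux).
have := etrans (esym (D u v)) (etrans (mx_smooth_on_schwarz u v oU sJ Ux) (D v u)).
have G s t : mx_derive s (cG t) x = complexify ('D_s (Gam t) x).
  exact: mx_derive_connection_form.
rewrite (G u v) (G v u) => S.
have cK : complexify (K u v x) = complexify ('D_u (Gam v) x) - complexify ('D_v (Gam u) x)
    + cG v x *m cG u x - cG u x *m cG v x.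
  by rewrite /cG -!complexifyM -complexifyB -complexifyD -complexifyB.
apply: complexify_inj; rewrite !complexifyM cK.
move: S; rewrite -/(cJ' x) /cG.
move: (complexify (Gam u x)) (complexify (Gam v x)) (cJ' x) => a b c.
move: (complexify ('D_v _ x)) (complexify ('D_u _ x)) => p q.
rewrite !(mulmxDl, mulmxDr, mulmxN, mulNmx, mulmxA).
(* Once the noncommutative monomials are named, the symmetry of second derivatives and the claim are
   the same linear identity, which [ring] checks entrywise. *)
move: (q *m c) (c *m q) (p *m c) (c *m p) => q1 q2 p1 p2.
move: (b *m a *m c) (b *m c *m a) (a *m c *m b) (c *m a *m b) => m1 m2 m3 m4.
move: (a *m b *m c) (c *m b *m a) => m5 m6 /eqP; rewrite -subr_eq0 => /eqP S0.
apply/eqP; rewrite -subr_eq0; apply/eqP; rewrite -[RHS]S0.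
by apply/matrixP => k l; rewrite !mxE; ring.
Qed.

End ParallelEndo.

(** * Parallel frames and volume forms *)

Lemma derive_comp (R : realType) (V W X : normedModType R) (f : V -> W) (g : W -> X) v x :
  differentiable f x -> differentiable g (f x) ->
  'D_v (g \o f) x = 'D_('D_v f x) g (f x).
Proof.
move=> df dg; rewrite (deriveE v (differentiable_comp df dg)) diff_comp //=.
by rewrite (deriveE v df) (deriveE _ dg).
Qed.

(** * Transition maps and their Jacobians *)

Section Atlas.
Variables (R : realType) (n : nat) (M : manifold R n).
Implicit Types (i j k : chart M) (V : set M) (p : M) (x y u v : 'rV[R]_n).

Lemma image_inE i V :
  image_in i V = (coords i @` domain i) `&` (param i @^-1` V).
Proof.
apply/seteqP; split => x /=.
  by move=> [p [dp Vp] <-]; split; [exists p|rewrite coordsK].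
by move=> [[p dp <-]]; rewrite coordsK // => Vp; exists p.
Qed.

Lemma image_in_open i V : open V -> open (image_in i V).
Proof.
move=> oV; rewrite image_inE openE => x [Ux Vx]; apply: filterI.
  by apply: open_nbhs_nbhs; split => //; exact: coords_open.
by apply: (param_continuous Ux); exact: open_nbhs_nbhs.
Qed.

Lemma chart_preimage_open i (B : set 'rV[R]_n) : open B ->
  open (domain i `&` (coords i @^-1` B)).
Proof.
move=> oB; rewrite openE => p [dp Bp]; apply: filterI.
  by apply: open_nbhs_nbhs; split => //; exact: domain_open.
by apply: (coords_continuous dp); exact: open_nbhs_nbhs.
Qed.

Lemma overlap_open i j V : open V -> open (overlap i j V).
Proof.
by move=> oV; apply: image_in_open; apply: openI => //; exact: domain_open.
Qed.

Lemma transition_coords i j p : domain i p ->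
  transition i j (coords i p) = coords j p.
Proof. by move=> dp; rewrite /transition /= coordsK. Qed.

Lemma transition_smooth_on i j V : smooth_on (overlap i j V) (transition i j).
Proof.
apply: smooth_on_subset (@transition_smooth _ _ M i j).
by move=> x [p [dip [djp _]] <-]; exists p.
Qed.

Lemma transition_differentiable i j x : overlap i j setT x ->
  differentiable (transition i j) x.
Proof. by move=> ox; exact: smooth_on_differentiable (@transition_smooth_on i j setT) ox. Qed.

Lemma derive_transition i j v x : overlap i j setT x ->
  'D_v (transition i j) x = v *m jacobian (transition i j) x.
Proof. by move=> ox; apply: deriveEjacobian; exact: transition_differentiable. Qed.

Lemma jacobian_transition_id i x : overlap i i setT x ->
  jacobian (transition i i) x = 1%:M.
Proof.
move=> ox; have oO : open (overlap i i (@setT M)) by apply: overlap_open; exact: openT.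
apply: mulmx_rV_inj => v; rewrite -derive_transition // mulmx1.
rewrite (@open_eq_derive _ _ _ (overlap i i setT) _ id) ?derive_id // => y [p [dp _] <-].
exact: transition_coords.
Qed.

Lemma jacobian_transition_comp i j k x : overlap i j (domain k) x ->
  jacobian (transition i k) x =
  jacobian (transition i j) x *m jacobian (transition j k) (transition i j x).
Proof.
move=> ox; have oO : open (overlap i j (domain k)).
  by apply: overlap_open; exact: domain_open.
have [p [dip [djp dkp]] px] := ox.
have oij : overlap i j setT x by exists p.
have oik : overlap i k setT x by exists p.
have ojk : overlap j k setT (transition i j x).
  by exists p => //; rewrite -px transition_coords.
apply: mulmx_rV_inj => v; apply: etrans (esym (derive_transition v oik)) _.
have <- : 'D_('D_v (transition i j) x) (transition j k) (transition i j x) =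
    v *m (jacobian (transition i j) x *m jacobian (transition j k) (transition i j x)).
  by rewrite (derive_transition _ ojk) (derive_transition v oij) mulmxA.
have E y : overlap i j (domain k) y ->
    transition i k y = (transition j k \o transition i j) y.
  by move=> [q [diq [djq dkq]] <-] /=; rewrite !transition_coords.
exact: (etrans (open_eq_derive v oO E ox)
  (derive_comp v (transition_differentiable oij) (transition_differentiable ojk))).
Qed.

Lemma jacobian_transition_smooth i j a b :
  smooth_on (overlap i j setT) (fun y => jacobian (transition i j) y a b : R^o).
Proof.
have oO : open (overlap i j (@setT M)) by apply: overlap_open; exact: openT.
(* Row [a] of the Jacobian is the derivative along the basis vector with index [a]. *)
have := smooth_on_entry 0 b oO
  (smooth_on_derive (delta_mx 0 a) (@transition_smooth_on i j setT)).
apply: eq_smooth_on => // y oy.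
by rewrite derive_transition // -rowE mxE.
Qed.

Variable nabla : connection M.

(** The transformation law of the Christoffel symbols, read as a differential equation for the
    Jacobian; it transports the frame equation from one chart to another. *)
Lemma jacobian_connection_form i j u x : overlap i j setT x ->
  'D_u (jacobian (transition i j)) x =
  connection_form nabla i u x *m jacobian (transition i j) x -
  jacobian (transition i j) x *m connection_form nabla j
    (u *m jacobian (transition i j) x) (transition i j x).
Proof.
move=> ox; have oO : open (overlap i j (@setT M)) by apply: overlap_open; exact: openT.
apply: mulmx_rV_inj => v.
have := @christoffel_compatible _ _ _ nabla i j x u v ox.
rewrite !christoffel_mapE.
rewrite (@open_eq_derive _ _ _ (overlap i j setT) _
  (fun y => v *m jacobian (transition i j) y)) //; last first.
  by move=> y oy; rewrite derive_transition.
rewrite derive_mulmxl; last first.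
  apply/derivable_mxP => a b; apply: diff_derivable.
  exact: (smooth_on_differentiable (@jacobian_transition_smooth i j a b) ox).
by rewrite mulmxBr !mulmxA => <-; rewrite addrK.
Qed.

End Atlas.

(** * Complex-valued maps under a change of variables *)

Section Pullback.
Variables (R : realType) (p n : nat).
Local Notation C := R[i].
Implicit Types (t : 'rV[R]_p -> 'rV[R]_n) (f : 'rV[R]_n -> C).

Lemma cdifferentiable_comp t f y : differentiable t y -> cdifferentiable f (t y) ->
  cdifferentiable (fun y => f (t y)) y.
Proof.
move=> dt [fr fi]; split; first exact: (differentiable_comp dt fr).
exact: (differentiable_comp dt fi).
Qed.

Lemma cderive_comp t f u y : differentiable t y -> cdifferentiable f (t y) ->
  cderive u (fun y => f (t y)) y = cderive ('D_u t y) f (t y).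
Proof.
move=> dt [fr fi].
exact: (f_equal2 (@Complex R) (derive_comp u dt fr) (derive_comp u dt fi)).
Qed.

Lemma csmooth_on_comp (U : set 'rV[R]_p) (V : set 'rV[R]_n) t f :
  open U -> (forall x, U x -> V (t x)) -> smooth_on U t -> csmooth_on V f ->
  csmooth_on U (fun y => f (t y)).
Proof.
move=> oU UV st [fr fi].
by split; [exact: (smooth_on_comp oU UV st fr)|exact: (smooth_on_comp oU UV st fi)].
Qed.

Lemma mx_derive_comp q r t (F : 'rV[R]_n -> 'M[C]_(q, r)) u y :
  differentiable t y -> mx_differentiable F (t y) ->
  mx_derive u (fun y => F (t y)) y = mx_derive ('D_u t y) F (t y).
Proof.
move=> dt dF; apply/matrixP => a b; rewrite mxE [RHS]mxE.
exact: (cderive_comp u dt (dF a b)).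
Qed.

End Pullback.

(** * Determinant forms of a frame *)

Section FrameForm.
Variables (R : realType) (n m : nat).
Local Notation C := R[i].

Lemma complexify_set_row (A : 'M[R]_(m, n)) a (w : 'rV[R]_n) (theta : 'M[C]_(n, m)) :
  complexify (set_row A a w) *m theta =
  \matrix_(b, c) (if b == a then (complexify w *m theta) 0 c
                  else (complexify A *m theta) b c).
Proof.
apply/matrixP => b c; rewrite !mxE; case: (b =P a) => [->|ba].
  by apply: eq_bigr => d _; rewrite !mxE eqxx.
by apply: eq_bigr => d _; rewrite !mxE (introF eqP ba) mxE.
Qed.

Lemma det_set_row (A : 'M[R]_(m, n)) a w (theta : 'M[C]_(n, m)) :
  \det (complexify (set_row A a w) *m theta) =
  (complexify w *m theta *m \adj (complexify A *m theta)) 0 a.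
Proof. by rewrite complexify_set_row det_replace_row. Qed.

(** The derivation that [G] induces on the determinant form. Cofactor expansion of each replaced row
    assembles the expression that Jacobi's formula also produces, so that the two can be
    compared. *)
Lemma sum_det_set_row (A : 'M[R]_(m, n)) (G : 'M[R]_n) (T : 'M[C]_(n, m)) :
  \sum_a \det (complexify (set_row A a (row a A *m G)) *m T) =
  \tr (complexify A *m (complexify G *m T) *m \adj (complexify A *m T)).
Proof.
apply: eq_bigr => a _; rewrite det_set_row complexifyM.
move: (\adj _) (complexify G) => D H.
have -> : complexify (row a A) = row a (complexify A) by apply/rowP => b; rewrite !mxE.
by rewrite -(mulmxA _ H T) -row_mul -row_mul [LHS]mxE.
Qed.

(* The derivative of exp(h) compensates the trace of the connection matrix B of theta. *)
Lemma frame_form_parallel (theta : 'rV[R]_n -> 'M[C]_(n, m)) (h : 'rV[R]_n -> C)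
    (G : 'M[R]_n) (B : 'M[C]_m) (A : 'M[R]_(m, n)) u y :
  mx_differentiable theta y -> cdifferentiable h y ->
  mx_derive u theta y = complexify G *m theta y + theta y *m B ->
  cderive u h y = - \tr B ->
  cderive u (fun y => cexp (h y) * \det (complexify A *m theta y)) y =
  \sum_a cexp (h y) * \det (complexify (set_row A a (row a A *m G)) *m theta y).
Proof.
move=> dt dh Dt Dh.
have dA : mx_differentiable (fun=> complexify A) y by exact: mx_differentiable_cst.
have dAt : mx_differentiable (fun y => complexify A *m theta y) y.
  exact: (mx_differentiableM dA dt).
have dE : cdifferentiable (fun y => cexp (h y)) y by exact: cdifferentiable_cexp.
have dD : cdifferentiable (fun y => \det (complexify A *m theta y)) y.
  exact: cdifferentiable_det.
rewrite (cderiveM u dE dD) (cderive_cexp u dh) (cderive_det u dAt) (mx_deriveM u dA dt).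
rewrite [mx_derive u (fun=> _) y]mx_derive_cst mul0mx add0r Dt Dh -mulr_sumr.
rewrite sum_det_set_row -mulrA -mulrDr; congr (_ * _).
move: (theta y) (complexify A) (complexify G) => T A' G'.
(* Since adj(N) N = det(N) for N = A' T, the [B] part contributes tr B times the determinant, which
   the derivative of the exponent removes. *)
have -> : \tr (A' *m (G' *m T + T *m B) *m \adj (A' *m T)) =
    \tr (A' *m (G' *m T) *m \adj (A' *m T)) + \tr B * \det (A' *m T).
  rewrite mulmxDr mulmxDl mxtraceD; congr (_ + _).
  rewrite (mulmxA A' T B); move: (A' *m T) => N.
  by rewrite -mulmxA mxtrace_mulC -mulmxA mul_adj_mx mul_mx_scalar mxtraceZ mulrC.
by rewrite mulNr addrCA addNr addr0.
Qed.

End FrameForm.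

(** * The trace of the connection matrix as a closed 1-form *)

Section TraceForm.
Variables (R : realType) (n m : nat) (M : manifold R n) (nabla : connection M).
Variables (i : chart M) (B : set 'rV[R]_n).
Local Notation C := R[i].
Local Notation Gam := (connection_form nabla i).
Local Notation K := (curvature_form nabla i).
Hypothesis oB : open B.
Hypothesis BU : B `<=` image_in i setT.
Variables (A0 : 'M[C]_(m, n)) (theta : 'rV[R]_n -> 'M[C]_(n, m)).
Hypothesis stheta : mx_smooth_on B theta.

(** Minus the trace of the connection matrix of [theta], hence the differential prescribed for the
    exponent. *)
Definition trace_form u y : C := \tr (A0 *m complexify (Gam u y) *m theta y).

Lemma trace_form_smooth u : csmooth_on B (trace_form u).
Proof.
apply: csmooth_on_sum => // k _.
have s1 : mx_smooth_on B (fun y => complexify (Gam u y)).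
  exact: mx_smooth_on_subset BU (mx_smooth_connection_form nabla i u).
exact: (mx_smooth_onM oB (mx_smooth_onM oB (mx_smooth_on_cst B A0) s1) stheta).
Qed.

Lemma trace_form_sum u y :
  trace_form u y = \sum_a (u 0 a)%:C%C * trace_form (delta_mx 0 a) y.
Proof.
rewrite /trace_form connection_form_sum.
have -> : complexify (\sum_a u 0 a *: Gam (delta_mx 0 a) y) =
    \sum_a (u 0 a)%:C%C *: complexify (Gam (delta_mx 0 a) y).
  by rewrite /complexify map_mx_sum; apply: eq_bigr => a _; rewrite map_mxZ.
rewrite mulmx_sumr mulmx_suml raddf_sum; apply: eq_bigr => a _.
by rewrite -scalemxAr -scalemxAl -mxtraceZ.
Qed.

Hypothesis dtheta : forall u y, B y -> mx_derive u theta y =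
  complexify (Gam u y) *m theta y - theta y *m (A0 *m complexify (Gam u y) *m theta y).
Hypothesis flat : forall u v y, B y -> \tr (A0 *m complexify (K u v y) *m theta y) = 0.

(* The quadratic terms in the connection matrix of theta cancel by symmetry of the
   trace. *)
Lemma trace_form_closed u v x : B x ->
  cderive v (trace_form u) x = cderive u (trace_form v) x.
Proof.
move=> Bx; have Ux := BU Bx.
have dG s := mx_smooth_on_differentiable (mx_smooth_connection_form nabla i s) Ux.
have dt := mx_smooth_on_differentiable stheta Bx.
have dA : mx_differentiable (fun=> A0) x by exact: mx_differentiable_cst.
have D s t : cderive s (trace_form t) x =
    \tr (A0 *m complexify ('D_s (Gam t) x) *m theta x +
         A0 *m complexify (Gam t x) *m (complexify (Gam s x) *m theta x -
           theta x *m (A0 *m complexify (Gam s x) *m theta x))).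
  have dAG := mx_differentiableM dA (dG t).
  rewrite (cderive_trace s (mx_differentiableM dAG dt)) (mx_deriveM s dAG dt).
  rewrite (mx_deriveM s dA (dG t)) [mx_derive s (fun=> _) x]mx_derive_cst mul0mx add0r.
  by rewrite (mx_derive_connection_form nabla t s Ux) (dtheta s Bx).
apply/eqP; rewrite -subr_eq0 (D u v) (D v u) -[X in _ == X](flat v u Bx).
have -> : complexify (K v u x) = complexify ('D_v (Gam u) x) - complexify ('D_u (Gam v) x)
    + complexify (Gam u x) *m complexify (Gam v x)
    - complexify (Gam v x) *m complexify (Gam u x).
  by rewrite -!complexifyM -complexifyB -complexifyD -complexifyB.
move: (complexify ('D_v _ x)) (complexify ('D_u _ x)) => p q.
move: (complexify (Gam u x)) (complexify (Gam v x)) (theta x) => g k t.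
rewrite !(mulmxDl, mulmxDr, mulmxBl, mulmxBr, mulNmx, mulmxN, mulmxA).
have S : \tr (A0 *m g *m t *m A0 *m k *m t) = \tr (A0 *m k *m t *m A0 *m g *m t).
  have E c d : A0 *m c *m t *m A0 *m d *m t = (A0 *m c *m t) *m (A0 *m d *m t).
    by rewrite !mulmxA.
  by rewrite !E mxtrace_mulC.
have trN (X : 'M[C]_m) : \tr (- X) = - \tr X by rewrite raddfN.
move: (A0 *m p *m t) (A0 *m q *m t) (A0 *m g *m k *m t) (A0 *m k *m g *m t) S => X1 X2 X3 X4.
move: (A0 *m g *m t *m A0 *m k *m t) (A0 *m k *m t *m A0 *m g *m t) => X5 X6 S.
by apply/eqP; rewrite !(mxtraceD, trN) S; ring.
Qed.

End TraceForm.

Lemma complex_poincare (R : realType) n (x0 : 'rV[R]_n) (r : R)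
    (beta : 'I_n -> 'rV[R]_n -> R[i]) :
  (forall a, csmooth_on (ball x0 r) (beta a)) ->
  (forall a b x, ball x0 r x ->
    cderive (delta_mx 0 b) (beta a) x = cderive (delta_mx 0 a) (beta b) x) ->
  exists h, csmooth_on (ball x0 r) h /\
    forall u x, ball x0 r x -> cderive u h x = \sum_a (u 0 a)%:C%C * beta a x.
Proof.
move=> sb cb.
have [fr [sr dr]] := @poincare_ball R n x0 r (fun a => re_fun (beta a))
  (fun a => (sb a).1) (fun a b x Bx => f_equal (@complex.Re R) (cb a b x Bx)).
have [fi [si di]] := @poincare_ball R n x0 r (fun a => im_fun (beta a))
  (fun a => (sb a).2) (fun a b x Bx => f_equal (@complex.Im R) (cb a b x Bx)).
exists (fun y => Complex (fr y) (fi y)); split; first by split.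
move=> u x Bx; rewrite /cderive.
have -> : re_fun (fun y => Complex (fr y) (fi y)) = fr by [].
have -> : im_fun (fun y => Complex (fr y) (fi y)) = fi by [].
rewrite (dr u x Bx) (di u x Bx).
elim/big_rec3 : _ => [|a y1 y2 y3 _ <-] //.
rewrite /re_fun /im_fun; case: (beta a x) => c d /=.
by apply/eqP; rewrite eq_complex /=; apply/andP; split; apply/eqP; ring.
Qed.

(** * Spreading the form from one chart to all charts *)

Section FrameConstruction.
Variables (R : realType) (n m : nat) (M : manifold R n) (nabla : connection M).
Variables (i : chart M) (B : set 'rV[R]_n).
Local Notation C := R[i].
Hypothesis oB : open B.
Hypothesis BU : B `<=` image_in i setT.
Variables (theta : 'rV[R]_n -> 'M[C]_(n, m)) (h : 'rV[R]_n -> C).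
Variable Bf : 'rV[R]_n -> 'rV[R]_n -> 'M[C]_m.
Hypothesis stheta : mx_smooth_on B theta.
Hypothesis sh : csmooth_on B h.
Hypothesis dtheta : forall u x, B x -> mx_derive u theta x =
  complexify (connection_form nabla i u x) *m theta x + theta x *m Bf u x.
Hypothesis dh : forall u x, B x -> cderive u h x = - \tr (Bf u x).

Definition chart_nbhs : set M := domain i `&` (coords i @^-1` B).
Local Notation V := chart_nbhs.
Local Notation t j := (transition j i).
Local Notation Jac j := (jacobian (transition j i)).

(** The columns of [theta] are covectors, so they pull back through the Jacobian of the transition
    to the chart [i]. *)
Definition frame_pullback (j : chart M) y : 'M[C]_(n, m) :=
  complexify (Jac j y) *m theta (t j y).

Definition frame_form (j : chart M) y (A : 'M[R]_(m, n)) : C :=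
  cexp (h (t j y)) * \det (complexify A *m frame_pullback j y).

Lemma chart_nbhs_open : open V.
Proof. exact: chart_preimage_open. Qed.

Lemma image_in_chart_nbhs j y : image_in j V y -> overlap j i setT y /\ B (t j y).
Proof.
move=> [p [dj [di Bp]] <-]; split; first by exists p.
by rewrite transition_coords.
Qed.

Lemma image_in_chart_nbhs_open j : open (image_in j V).
Proof. by apply: image_in_open; exact: chart_nbhs_open. Qed.

Lemma transition_smooth_chart_nbhs j : smooth_on (image_in j V) (t j).
Proof.
apply: smooth_on_subset (@transition_smooth_on R n M j i setT).
by move=> y /image_in_chart_nbhs [].
Qed.

Lemma jacobian_smooth_chart_nbhs j : mx_smooth_on (image_in j V)
  (fun y => complexify (Jac j y)).
Proof.
apply: mx_smooth_on_real => a b.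
apply: smooth_on_subset (@jacobian_transition_smooth R n M j i a b).
by move=> y /image_in_chart_nbhs [].
Qed.

Lemma frame_pullback_smooth j : mx_smooth_on (image_in j V) (frame_pullback j).
Proof.
have oW := @image_in_chart_nbhs_open j.
apply: (mx_smooth_onM oW (jacobian_smooth_chart_nbhs j)) => a b.
apply: (csmooth_on_comp oW _ (@transition_smooth_chart_nbhs j) (stheta a b)).
by move=> y /image_in_chart_nbhs [].
Qed.

Lemma exponent_pullback_smooth j : csmooth_on (image_in j V) (fun y => h (t j y)).
Proof.
have oW := @image_in_chart_nbhs_open j.
apply: (csmooth_on_comp oW _ (@transition_smooth_chart_nbhs j) sh).
by move=> y /image_in_chart_nbhs [].
Qed.

Lemma frame_form_smooth j A : csmooth_on (image_in j V) (fun y => frame_form j y A).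
Proof.
have oW := @image_in_chart_nbhs_open j.
apply: (csmooth_onM oW (csmooth_on_cexp oW (exponent_pullback_smooth j))).
apply: (csmooth_on_det oW).
exact: (mx_smooth_onM oW (mx_smooth_on_cst _ (complexify A)) (@frame_pullback_smooth j)).
Qed.

Lemma mx_derive_frame_pullback j u y : image_in j V y ->
  mx_derive u (frame_pullback j) y =
  complexify (connection_form nabla j u y) *m frame_pullback j y +
  frame_pullback j y *m Bf (u *m Jac j y) (t j y).
Proof.
move=> Wy; have [oy By] := image_in_chart_nbhs Wy.
have dt := transition_differentiable oy.
have dJ := mx_smooth_on_differentiable (jacobian_smooth_chart_nbhs j) Wy.
have dth := mx_smooth_on_differentiable stheta By.
have dtht : mx_differentiable (fun y => theta (t j y)) y.
  by move=> a b; exact: (cdifferentiable_comp dt (dth a b)).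
rewrite /frame_pullback (mx_deriveM u dJ dtht) (mx_derive_comp u dt dth).
rewrite (derive_transition u oy) (dtheta _ By).
have -> : mx_derive u (fun y => complexify (Jac j y)) y = complexify ('D_u (Jac j) y).
  apply: mx_derive_real => a b.
  exact: (smooth_on_differentiable (@jacobian_transition_smooth R n M j i a b) oy).
(* The derivative of the Jacobian brings in the connection form of the chart [j] and cancels that of
   the chart [i]. *)
rewrite (jacobian_connection_form nabla u oy) complexifyB !complexifyM.
move: (complexify _) (complexify _) (complexify _) => g jac g'.
by rewrite mulmxBl mulmxDr !mulmxA addrA subrK.
Qed.

Lemma cderive_exponent_pullback j u y : image_in j V y ->
  cderive u (fun y => h (t j y)) y = - \tr (Bf (u *m Jac j y) (t j y)).
Proof.
move=> Wy; have [oy By] := image_in_chart_nbhs Wy.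
have dt := transition_differentiable oy.
rewrite (cderive_comp u dt (csmooth_on_differentiable sh By)).
by rewrite (derive_transition u oy) dh.
Qed.

Lemma re_sum k (F : 'I_k -> C) : complex.Re (\sum_a F a) = \sum_a complex.Re (F a).
Proof. by rewrite (big_morph (@complex.Re R) (id1 := 0) (op1 := +%R)) // => -[? ?] []. Qed.

Lemma im_sum k (F : 'I_k -> C) : complex.Im (\sum_a F a) = \sum_a complex.Im (F a).
Proof. by rewrite (big_morph (@complex.Im R) (id1 := 0) (op1 := +%R)) // => -[? ?] []. Qed.

Lemma frame_form_derive j u y A : image_in j V y ->
  cderive u (fun y => frame_form j y A) y =
  \sum_a frame_form j y
    (set_row A a (christoffel_map (christoffel nabla j) y u (row a A))).
Proof.
move=> Wy.
have dth := mx_smooth_on_differentiable (@frame_pullback_smooth j) Wy.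
have dhh := csmooth_on_differentiable (exponent_pullback_smooth j) Wy.
have E := frame_form_parallel A dth dhh (mx_derive_frame_pullback u Wy)
  (cderive_exponent_pullback u Wy).
apply: (etrans E); apply: eq_bigr => a _.
by rewrite /frame_form christoffel_mapE.
Qed.

Lemma frame_form_re_parallel : parallel_form_on nabla V (re_form frame_form).
Proof.
move=> j y u A Wy; rewrite /covariant_form /re_form -re_sum -(frame_form_derive u A Wy).
exact: subrr.
Qed.

Lemma frame_form_im_parallel : parallel_form_on nabla V (im_form frame_form).
Proof.
move=> j y u A Wy; rewrite /covariant_form /im_form -im_sum -(frame_form_derive u A Wy).
exact: subrr.
Qed.

Lemma frame_form_linear j y A a (c : R) (u w : 'rV[R]_n) :
  frame_form j y (set_row A a (c *: u + w)) =
  c%:C%C * frame_form j y (set_row A a u) + frame_form j y (set_row A a w).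
Proof.
rewrite /frame_form !det_set_row.
have -> : complexify (c *: u + w) = c%:C%C *: complexify u + complexify w.
  by rewrite complexifyD /complexify map_mxZ.
by rewrite !mulmxDl -!scalemxAl !mxE mulrDr mulrCA.
Qed.

Lemma frame_form_alternate j y A (a b : 'I_m) : a != b -> row a A = row b A ->
  frame_form j y A = 0.
Proof.
move=> ab rab; rewrite /frame_form (determinant_alternate ab) ?mulr0 // => c.
rewrite !mxE; apply: eq_bigr => d _; rewrite !mxE.
by have /rowP/(_ d) := rab; rewrite !mxE => ->.
Qed.

Lemma frame_form_compat j k y A : overlap j k V y ->
  frame_form j y A = frame_form k (transition j k y) (A *m jacobian (transition j k) y).
Proof.
move=> oy; have [p [djp [dkp [dip Bp]]] py] := oy.
rewrite /frame_form /frame_pullback complexifyM -!mulmxA.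
have -> : transition k i (transition j k y) = transition j i y.
  by rewrite -py !transition_coords.
have ojki : overlap j k (domain i) y by exists p.
by rewrite (jacobian_transition_comp ojki) complexifyM -!mulmxA.
Qed.

Lemma frame_form_re_form : real_form_on V (re_form frame_form).
Proof.
split=> [j y Wy|j A|j k y A oy].
- split=> [A a c u w|A a b ab rab]; rewrite /re_form.
    rewrite frame_form_linear.
    by case: (frame_form j y _) (frame_form j y _) => [? ?] [? ?] /=; rewrite mul0r subr0.
  by rewrite (frame_form_alternate _ _ ab).
- exact: (frame_form_smooth j A).1.
- by rewrite /re_form (frame_form_compat A oy).
Qed.

Lemma frame_form_im_form : real_form_on V (im_form frame_form).
Proof.
split=> [j y Wy|j A|j k y A oy].
- split=> [A a c u w|A a b ab rab]; rewrite /im_form.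
    rewrite frame_form_linear.
    by case: (frame_form j y _) (frame_form j y _) => [? ?] [? ?] /=; rewrite mul0r addr0.
  by rewrite (frame_form_alternate _ _ ab).
- exact: (frame_form_smooth j A).2.
- by rewrite /im_form (frame_form_compat A oy).
Qed.

Lemma frame_form_type10 (J : chart M -> 'rV[R]_n -> 'M[R]_n) :
  complex_structure J ->
  (forall x, B x -> complexify (J i x) *m theta x = 'i%C *: theta x) ->
  forall j y A a, image_in j V y ->
    frame_form j y (set_row A a (row a A *m J j y)) = 'i%C * frame_form j y A.
Proof.
move=> [_ cJ _] Jt j y A a Wy; have [oy By] := image_in_chart_nbhs Wy.
have E : complexify (J j y) *m frame_pullback j y = 'i%C *: frame_pullback j y.
  rewrite /frame_pullback mulmxA -complexifyM cJ // complexifyM -mulmxA Jt //.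
  by rewrite scalemxAr.
(* Viewing [A] as a row replacement of itself puts both sides in the form expanded by
   [det_set_row]. *)
have rowK : set_row A a (row a A) = A.
  by apply/matrixP => b c; rewrite !mxE; case: eqP => [->|_]; rewrite !mxE.
rewrite -[in RHS]rowK /frame_form !det_set_row complexifyM.
rewrite -(mulmxA _ (complexify (J j y))) E.
by rewrite -scalemxAr -scalemxAl mxE mulrCA.
Qed.

(** The two Jacobians are inverse to each other, so the pullback is undone and nonvanishing in any
    chart can be tested in the chart [i]. *)
Lemma frame_form_transition j y (A : 'M[R]_(m, n)) : image_in j V y ->
  frame_form j y (A *m jacobian (transition i j) (t j y)) =
  cexp (h (t j y)) * \det (complexify A *m theta (t j y)).
Proof.
move=> [p [djp [dip Bp]] <-]; rewrite /frame_form /frame_pullback !transition_coords //.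
congr (_ * \det _); rewrite complexifyM -mulmxA; congr (_ *m _).
rewrite mulmxA -complexifyM.
have o1 : overlap i j (domain i) (coords i p) by exists p.
have o2 : overlap i i setT (coords i p) by exists p.
have := jacobian_transition_comp o1.
rewrite jacobian_transition_id // transition_coords // => <-.
by rewrite /complexify map_scalar_mx rmorph1 mul1mx.
Qed.

End FrameConstruction.

(** * Local existence of the parallel volume forms *)

Section LocalFrame.
Variables (R : realType) (n : nat) (M : manifold R n) (nabla : connection M).
Hypothesis tf : torsion_free nabla.
Hypothesis rf : ricci_flat nabla.
Variable i : chart M.
Local Notation C := R[i].
Local Notation U := (image_in i setT).
Local Notation Gam := (connection_form nabla i).
Local Notation K := (curvature_form nabla i).

Lemma curvature_form_trace u v x : U x -> \tr (K u v x) = 0.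
Proof.
move=> Ux; rewrite -[K u v x]mul1mx.
by apply: (ricci_flat_trace tf rf Ux) => s t; rewrite mulmx1 mul1mx.
Qed.

Lemma trace_complexify k (A : 'M[R]_k) : \tr (complexify A) = (\tr A)%:C%C.
Proof. exact: trace_map_mx. Qed.

(** With [A0] and [theta] both the identity, [trace_form] is the trace of the connection form, and
    both sides of the frame equation vanish. *)
Lemma real_potential x0 (r : R) : ball x0 r `<=` U ->
  exists f : 'rV[R]_n -> R^o, smooth_on (ball x0 r) f /\
    forall u x, ball x0 r x -> 'D_u f x = \tr (Gam u x).
Proof.
move=> BU; have oB : open (ball x0 r) by exact: ball_open.
pose th : 'rV[R]_n -> 'M[C]_n := cst 1%:M.
have sth : mx_smooth_on (ball x0 r) th by exact: mx_smooth_on_cst.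
have tfE u y : trace_form nabla i 1%:M th u y = (\tr (Gam u y))%:C%C.
  by rewrite /trace_form mul1mx mulmx1 trace_complexify.
have reE u : re_fun (trace_form nabla i 1%:M th u) = fun y => \tr (Gam u y).
  by apply/funext => y; rewrite /re_fun tfE.
have dth u y : ball x0 r y -> mx_derive u th y = complexify (Gam u y) *m th y -
    th y *m (1%:M *m complexify (Gam u y) *m th y).
  by move=> _; rewrite [LHS]mx_derive_cst !mul1mx subrr.
have fl u v y : ball x0 r y -> \tr (1%:M *m complexify (K u v y) *m th y) = 0.
  move=> By; rewrite mul1mx mulmx1 trace_complexify curvature_form_trace //.
  exact: BU.
have [f [sf df]] := @poincare_ball R n x0 r
  (fun a => re_fun (trace_form nabla i 1%:M th (delta_mx 0 a)))
  (fun a => (trace_form_smooth nabla oB BU 1%:M sth (delta_mx 0 a)).1)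
  (fun a b x Bx => f_equal (@complex.Re R)
    (trace_form_closed BU sth dth fl (delta_mx 0 a) (delta_mx 0 b) Bx)).
exists f; split => // u x Bx; rewrite df // connection_form_sum raddf_sum /=.
by apply: eq_bigr => a _; rewrite reE mxtraceZ.
Qed.

Lemma ball_in_chart p : domain i p ->
  exists2 r : R, 0 < r & ball (coords i p) r `<=` U.
Proof.
move=> dp; have oU : open U by exact: image_inT_open.
have Up : U (coords i p) by exists p.
have [r /= r0 rU] := (nbhs_ballP _ _).1 (open_nbhs_nbhs (conj oU Up)).
by exists r.
Qed.

Lemma chart_nbhs_open_nbhs (B : set 'rV[R]_n) p : open B -> domain i p ->
  B (coords i p) -> open_nbhs p (chart_nbhs i B).
Proof. by move=> oB dp Bp; split; [exact: chart_nbhs_open|split]. Qed.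

Lemma real_volume_form p : domain i p -> exists V : set M, open_nbhs p V /\
  exists omega : chart M -> 'rV[R]_n -> 'M[R]_(n, n) -> R,
    preserved_real_volume_form_on nabla V omega.
Proof.
move=> dp; have [r r0 BU] := ball_in_chart dp.
set B := ball _ _ in BU; have oB : open B by exact: ball_open.
have [f [sf df]] := real_potential BU.
pose th : 'rV[R]_n -> 'M[C]_n := cst 1%:M.
pose h : 'rV[R]_n -> C := fun y => (f y)%:C%C.
pose Bf u x := - complexify (Gam u x).
have sth : mx_smooth_on B th by exact: mx_smooth_on_cst.
have sh : csmooth_on B h by exact: csmooth_on_real.
have dth u x : B x -> mx_derive u th x = complexify (Gam u x) *m th x + th x *m Bf u x.
  by move=> Bx; rewrite [LHS]mx_derive_cst mulmx1 mul1mx addrN.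
have dh u x : B x -> cderive u h x = - \tr (Bf u x).
  move=> Bx; rewrite cderive_real df // -trace_complexify.
  by rewrite /Bf [X in - X]raddfN opprK.
exists (chart_nbhs i B); split.
  by apply: chart_nbhs_open_nbhs => //; exact: ballxx.
exists (re_form (frame_form i th h)); split.
- exact: (frame_form_re_form i oB sth sh).
(* The coordinate frame of the chart [i], carried to the chart [j]; as [h] is real, the form takes
   the value exp(f) on it. *)
- move=> j y Wy; exists (1%:M *m jacobian (transition i j) (transition j i y)).
  rewrite /re_form (frame_form_transition th h 1%:M Wy) mulmx1.
  rewrite [complexify _](_ : _ = 1%:M); last by rewrite /complexify map_scalar_mx rmorph1.
  by rewrite det1 mulr1 /= cos0 mulr1 gt_eqF ?expR_gt0.
- exact: (frame_form_re_parallel oB sth sh dth dh).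
Qed.

Section ComplexFrame.
Variables (m : nat) (J : chart M -> 'rV[R]_n -> 'M[R]_n).
Hypothesis n2m : n = (2 * m)%N.
Hypothesis cJ : complex_structure J.
Hypothesis pJ : parallel_endo nabla J.

Let J2 x : U x -> J i x *m J i x = - 1%:M.
Proof. by case: cJ => _ _; exact. Qed.

Let P x := type10_proj (J i x).

Lemma type10_proj_smooth : mx_smooth_on U P.
Proof.
have oU : open U by exact: image_inT_open.
have sJ := mx_smooth_complex_structure i cJ.
move=> a b; apply: (eq_csmooth_on oU
  (f := fun y => (cst (2^-1 * (1%:M : 'M[C]_n) a b) y) +
     (cst (2^-1 * - 'i%C) y) * complexify (J i y) a b)).
  move=> y _; rewrite /P /type10_proj /cst !mxE; ring.
apply: (csmooth_onD oU); first exact: csmooth_on_cst.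
by apply: (csmooth_onM oU); [exact: csmooth_on_cst|exact: sJ].
Qed.

(** N = A0 P T is the identity at the centre, hence invertible nearby. The columns of P T lie in the
    i-eigenspace, and multiplication by the inverse of N on the right normalises them. *)
Lemma complex_frame p : domain i p ->
  exists r : R, exists A0 : 'M[R]_(m, n), exists theta : 'rV[R]_n -> 'M[C]_(n, m),
  let B := ball (coords i p) r in
  [/\ 0 < r, B `<=` U, mx_smooth_on B theta,
      forall x, B x -> complexify A0 *m theta x = 1%:M &
      forall x, B x -> complexify (J i x) *m theta x = 'i%C *: theta x].
Proof.
move=> dp; set x0 := coords i p.
have oU : open U by exact: image_inT_open.
have Ux0 : U x0 by exists p.
have [A0 [T A0T]] := exists_frame (J2 Ux0) n2m.
pose N x := complexify A0 *m P x *m T.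
have sN : mx_smooth_on U N.
  apply: (mx_smooth_onM oU _ (mx_smooth_on_cst _ T)).
  exact: (mx_smooth_onM oU (mx_smooth_on_cst _ (complexify A0)) type10_proj_smooth).
pose D x := \det (N x).
have sD : csmooth_on U D by exact: (csmooth_on_det oU sN).
have D1 : re_fun D x0 = 1 by rewrite /re_fun /D /N A0T det1.
have cD : {for x0, continuous (re_fun D)}.
  by apply: differentiable_continuous; exact: (smooth_on_differentiable sD.1 Ux0).
(* A positive real part is an open condition and forces the determinant to be nonzero. *)
have nD : \forall x \near x0, 0 < re_fun D x.
  by apply: (cvgr_gt (re_fun D x0) cD); rewrite D1 ltr01.
have [r /= r0 rUD] := (nbhs_ballP _ _).1 (filterI (open_nbhs_nbhs (conj oU Ux0)) nD).
have BU : ball x0 r `<=` U by move=> x /rUD [].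
have oB : open (ball x0 r) by exact: ball_open.
have DN x : ball x0 r x -> \det (N x) != 0.
  move=> /rUD [_ +]; apply: contraTneq => D0; rewrite /re_fun /D D0 ltxx //.
exists r, A0, (fun x => P x *m T *m invmx (N x)); split => //.
- apply: (mx_smooth_onM oB).
    apply: (mx_smooth_onM oB); last exact: mx_smooth_on_cst.
    exact: (mx_smooth_on_subset BU type10_proj_smooth).
  exact: (mx_smooth_on_inv oB (mx_smooth_on_subset BU sN) DN).
- move=> x Bx; rewrite !mulmxA mulmxV //.
  by rewrite unitmxE unitfE DN.
- move=> x Bx; rewrite !mulmxA mulmx_type10_proj; last exact: J2 (BU x Bx).
  by rewrite !scalemxAl.
Qed.

(** Since J is parallel, differentiating J theta = i theta shows that N = nabla_u theta stays in the
    i-eigenspace, so N = theta A0 N. Differentiating A0 theta = 1 gives A0 N = - A0 Gam_u theta. *)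
Lemma complex_frame_derive (B : set 'rV[R]_n) (A0 : 'M[R]_(m, n)) theta u x :
  open B -> B `<=` U -> mx_smooth_on B theta ->
  (forall x, B x -> complexify A0 *m theta x = 1%:M) ->
  (forall x, B x -> complexify (J i x) *m theta x = 'i%C *: theta x) -> B x ->
  mx_derive u theta x = complexify (Gam u x) *m theta x -
    theta x *m (complexify A0 *m complexify (Gam u x) *m theta x).
Proof.
move=> oB BU sth Ath Jth Bx; have Ux := BU x Bx.
have dth := mx_smooth_on_differentiable sth Bx.
have dJ := mx_smooth_on_differentiable (mx_smooth_complex_structure i cJ) Ux.
have dc k l (c : 'M[C]_(k, l)) : mx_differentiable (fun=> c) x by exact: mx_differentiable_cst.
have A0d : complexify A0 *m mx_derive u theta x = 0.
  have := open_eq_mx_derive u oB Ath Bx.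
  rewrite (mx_deriveM u (dc _ _ (complexify A0)) dth).
  rewrite [mx_derive u (fun=> complexify A0) x]mx_derive_cst.
  by rewrite mul0mx add0r [X in _ = X -> _]mx_derive_cst.
have Jd : complexify (J i x) *m mx_derive u theta x = 'i%C *: mx_derive u theta x
    - complexify (Gam u x) *m ('i%C *: theta x)
    + complexify (J i x) *m complexify (Gam u x) *m theta x.
  have E y : B y -> complexify (J i y) *m theta y = 'i%C%:M *m theta y.
    by move=> By; rewrite Jth // mul_scalar_mx.
  have := open_eq_mx_derive u oB E Bx.
  rewrite (mx_deriveM u dJ dth) (mx_deriveM u (dc _ _ 'i%C%:M) dth).
  rewrite [mx_derive u (fun=> 'i%C%:M) x]mx_derive_cst mul0mx add0r mul_scalar_mx => <-.
  rewrite (mx_derive_complex_structure cJ pJ u Ux) mulmxBl.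
  rewrite -(mulmxA (complexify (Gam u x)) _ (theta x)) Jth //.
  move: (complexify (Gam u x) *m _) (complexify (J i x) *m complexify (Gam u x) *m _) => a b.
  move: (complexify (J i x) *m mx_derive u theta x) => c.
  by apply/matrixP => k l; rewrite !mxE; ring.
pose N := mx_derive u theta x - complexify (Gam u x) *m theta x.
have JN : complexify (J i x) *m N = 'i%C *: N.
  by rewrite /N mulmxBr Jd scalerBr -scalemxAr mulmxA addrK.
have := eigenspace_factor (J2 Ux) n2m (Ath x Bx) (Jth x Bx) JN.
rewrite {1}/N mulmxBr A0d sub0r (mulmxA (complexify A0)) mulmxN => E.
by rewrite E /N addrC subrK.
Qed.

Lemma curvature_form_type10_trace (A0 : 'M[R]_(m, n)) (T : 'M[C]_(n, m)) u v x : U x ->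
  complexify A0 *m T = 1%:M -> complexify (J i x) *m T = 'i%C *: T ->
  \tr (complexify A0 *m complexify (K u v x) *m T) = 0.
Proof.
move=> Ux AT JT; have comm s t := curvature_form_comm cJ pJ s t Ux.
apply: (trace_type10 (J2 Ux) n2m AT JT).
- by rewrite -!complexifyM comm.
- by rewrite trace_complexify curvature_form_trace.
- by rewrite -complexifyM trace_complexify (ricci_flat_trace tf rf Ux comm).
Qed.

Lemma complex_volume_form p : domain i p -> exists V : set M, open_nbhs p V /\
  exists Omega : chart M -> 'rV[R]_n -> 'M[R]_(m, n) -> C,
    preserved_complex_volume_form_on nabla J V Omega.
Proof.
move=> dp; have [r [A0 [th []]]] := complex_frame dp.
set B := ball _ _ => r0 BU sth Ath Jth; have oB : open B by exact: ball_open.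
have dth' u x Bx := complex_frame_derive u oB BU sth Ath Jth (x := x) Bx.
have fl u v y : B y -> \tr (complexify A0 *m complexify (K u v y) *m th y) = 0.
  move=> By; apply: curvature_form_type10_trace (Ath y By) (Jth y By).
  exact: BU.
have [h [sh dh']] := @complex_poincare R n (coords i p) r
  (fun a => trace_form nabla i (complexify A0) th (delta_mx 0 a))
  (fun a => trace_form_smooth nabla oB BU (complexify A0) sth (delta_mx 0 a))
  (fun a b x Bx => trace_form_closed BU sth dth' fl (delta_mx 0 a) (delta_mx 0 b) Bx).
pose Bf u x := - (complexify A0 *m complexify (Gam u x) *m th x).
have dth u x : B x -> mx_derive u th x = complexify (Gam u x) *m th x + th x *m Bf u x.
  by move=> Bx; rewrite dth' // mulmxN.
have dh u x : B x -> cderive u h x = - \tr (Bf u x).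
  by move=> Bx; rewrite dh' // -trace_form_sum /Bf [X in - X]raddfN opprK.
exists (chart_nbhs i B); split.
  by apply: chart_nbhs_open_nbhs => //; exact: ballxx.
exists (frame_form i th h); split.
- split; [exact: (frame_form_re_form i oB sth sh)|exact: (frame_form_im_form i oB sth sh)|].
  by move=> j y A a Wy; exact: (frame_form_type10 h cJ Jth A a Wy).
(* The rows of [A0], carried to the chart [j]; the normalisation makes the determinant 1 there. *)
- move=> j y Wy; exists (A0 *m jacobian (transition i j) (transition j i y)).
  have [_ By] := image_in_chart_nbhs Wy.
  by rewrite (frame_form_transition th h A0 Wy) Ath // det1 mulr1 cexp_neq0.
- exact: (frame_form_re_parallel oB sth sh dth dh).
- exact: (frame_form_im_parallel oB sth sh dth dh).
Qed.

End ComplexFrame.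

End LocalFrame.

Theorem proposition3p3 (R : realType) (n : nat) (M : manifold R n)
    (nabla : connection M) (tf : torsion_free nabla) (rf : ricci_flat nabla) :
  (forall p : M, exists V : set M, open_nbhs p V /\
     exists omega : chart M -> 'rV[R]_n -> 'M[R]_(n, n) -> R,
       preserved_real_volume_form_on nabla V omega)
  /\
  (forall (m : nat) (J : chart M -> 'rV[R]_n -> 'M[R]_n),
     n = (2 * m)%N -> complex_structure J -> parallel_endo nabla J ->
     forall p : M, exists V : set M, open_nbhs p V /\
       exists Omega : chart M -> 'rV[R]_n -> 'M[R]_(m, n) -> R[i]%C,
         preserved_complex_volume_form_on nabla J V Omega).
Proof.
split=> [p|m J n2m cJ pJ p]; have [i dp] := domain_cover p.
  exact: (real_volume_form tf rf dp).
exact: (complex_volume_form tf rf n2m cJ pJ dp).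
Qed.
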